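(* Let $R$ be a commutative Noetherian ring with non-zero identity, $\mathfrak a$ an ideal of $R$, $M$ a finitely generated $R$-module, $X$ an arbitrary $R$-module and $n$ a non-negative integer such that $H^i_{\mathfrak a}(M,X)=0$ for all $i<n$. Then $$\operatorname{Ass}_R(H^n_{\mathfrak a}(M,X))=\operatorname{Ass}_R(\operatorname{Ext}^n_R(M/\mathfrak aM,X)).$$
   Context: $H^i_{\mathfrak a}(M,X)=\varinjlim_{k}\operatorname{Ext}^i_R(M/\mathfrak a^kM,X)$ is the $i$-th generalized local cohomology module. *)

(* Defs.v *)
From HB Require Import structures.
From mathcomp Require Import all_boot all_algebra ring_quotient finmap.
From mathcomp Require Import boolp classical_sets functions.
From mathcomp Require Import monalg.

Set Implicit Arguments.
Unset Strict Implicit.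
Unset Printing Implicit Defensive.

Import GRing.Theory.
Local Open Scope ring_scope.
Local Open Scope quotient_scope.
Local Open Scope classical_set_scope.

Section Span.
Variables (R : comNzRingType) (V : lmodType R).
Implicit Type A : set V.

Definition is_submod A := submod_closed [pred x | x \in A].

Definition span A : set V := smallest is_submod A.

Definition span_pred A : {pred V} := [pred x | x \in span A].

Lemma span_predE A x : (x \in span_pred A) = (span A x) :> Prop.
Proof. by rewrite !inE. Qed.

Lemma span_pred_closed A : submod_closed (span_pred A).
Proof.
split=> [|c x y].
  by rewrite span_predE => B [[+ _] _]; rewrite !inE.
rewrite !span_predE => Ax Ay B BA; have [[_ Blin] _] := BA.
move: (Blin c x y); rewrite !inE; apply; [exact: Ax|exact: Ay].
Qed.

HB.instance Definition _ A :=
  GRing.isSubmodClosed.Build R V (span_pred A) (span_pred_closed A).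

Lemma span0 A : span A 0.
Proof. by rewrite -span_predE rpred0. Qed.

Lemma spanP A c x y : span A x -> span A y -> span A (c *: x + y).
Proof. by rewrite -!span_predE => Ax Ay; rewrite rpredD ?rpredZ. Qed.

Lemma spanZ A c x : span A x -> span A (c *: x).
Proof. by rewrite -!span_predE => Ax; rewrite rpredZ. Qed.

Lemma span_submod A : is_submod (span A).
Proof.
by split=> [|c x y]; rewrite !inE; [exact: span0|exact: spanP].
Qed.

Lemma span_mono A B : A `<=` B -> span A `<=` span B.
Proof. by apply: sub_smallest2r; exact: span_submod. Qed.

Definition fin_gen A := exists s : seq V, A = span [set` s].

End Span.

Section Ideals.
Variable R : comNzRingType.
Implicit Types I p : set R.

Definition is_ideal I := @is_submod R R^o I.

Definition noetherian := forall I, is_ideal I -> @fin_gen R R^o I.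

Definition prime_ideal p :=
  [/\ is_ideal p, ~ p 1 & forall x y, p (x * y) -> p x \/ p y].

Definition Ass (V : lmodType R) : set (set R) :=
  [set p | prime_ideal p /\ exists x : V, p = [set r | r *: x = 0]].

Definition ideal_mul (V : lmodType R) I (A : set V) : set V :=
  span [set r *: x | r in I & x in A].

Definition ideal_exp I k : set R :=
  iter k (fun J => @ideal_mul R^o I J) [set: R].

End Ideals.

(* For an arbitrary set S, quotmod S is the quotient of V by the submodule
   generated by S, i.e. V / S as soon as S is a submodule. *)
Section QuotientModule.
Variables (R : comNzRingType) (V : lmodType R) (S : set V).

Definition quotmod : Type := Quotient.quot (span_pred S).

HB.instance Definition _ := GRing.Zmodule.on quotmod.

Definition quotmod_proj (x : V) : quotmod := \pi_(Quotient.quot (span_pred S)) x.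

Lemma quotmod_projP x y :
  (quotmod_proj x = quotmod_proj y) <-> span S (x - y).
Proof.
split=> [/eqP|xy]; last apply/eqP.
  by rewrite /quotmod_proj -Quotient.idealrBE => /set_mem.
by rewrite /quotmod_proj -Quotient.idealrBE span_predE.
Qed.

Lemma quotmod_reprK (q : quotmod) : quotmod_proj (repr q) = q.
Proof. exact: reprK. Qed.

Lemma quotmod_projD x y :
  quotmod_proj (x + y) = quotmod_proj x + quotmod_proj y.
Proof. exact: raddfD. Qed.

Definition quotmod_scale (r : R) (q : quotmod) : quotmod :=
  quotmod_proj (r *: repr q).

Lemma quotmod_scale_proj r x :
  quotmod_scale r (quotmod_proj x) = quotmod_proj (r *: x).
Proof.
apply/quotmod_projP; rewrite -scalerBr; apply: spanZ.
by apply/quotmod_projP; exact: quotmod_reprK.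
Qed.

Fact quotmod_scaleA r s q :
  quotmod_scale r (quotmod_scale s q) = quotmod_scale (r * s) q.
Proof. by rewrite -[q]quotmod_reprK !quotmod_scale_proj scalerA. Qed.

Fact quotmod_scale1 : left_id 1 quotmod_scale.
Proof. by move=> q; rewrite -[q]quotmod_reprK quotmod_scale_proj scale1r. Qed.

Fact quotmod_scaleDr : right_distributive quotmod_scale +%R.
Proof.
move=> r p q; rewrite -[p]quotmod_reprK -[q]quotmod_reprK -quotmod_projD.
by rewrite !quotmod_scale_proj scalerDr quotmod_projD.
Qed.

Fact quotmod_scaleDl q : {morph quotmod_scale^~ q : r s / r + s}.
Proof.
move=> r s; rewrite -[q]quotmod_reprK !quotmod_scale_proj.
by rewrite scalerDl quotmod_projD.
Qed.

HB.instance Definition _ := GRing.Zmodule_isLmodule.Build R quotmod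
  quotmod_scaleA quotmod_scale1 quotmod_scaleDr quotmod_scaleDl.

Fact quotmod_proj_linear : linear quotmod_proj.
Proof.
by move=> r x y; rewrite quotmod_projD -quotmod_scale_proj.
Qed.

HB.instance Definition _ :=
  GRing.isLinear.Build R V quotmod *:%R quotmod_proj quotmod_proj_linear.

End QuotientModule.

Section QuotientMap.
Variables (R : comNzRingType) (V W : lmodType R) (S : set V) (T : set W).
Variables (f : {linear V -> W}) (fST : forall x, S x -> span T (f x)).

Definition quotmod_map of (forall x, S x -> span T (f x)) :
  quotmod S -> quotmod T := fun q => quotmod_proj T (f (repr q)).

Lemma quotmod_map_proj x :
  quotmod_map fST (quotmod_proj S x) = quotmod_proj T (f x).
Proof.
apply/quotmod_projP; rewrite -linearB.
have /quotmod_projP := quotmod_reprK (quotmod_proj S x).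
move=> /(_ (fun y => span T (f y))); apply; split=> [|z Sz]; last exact: fST.
split=> [|c z t]; rewrite !inE; first by rewrite linear0; exact: span0.
by move=> Tz Tt; rewrite linearP; exact: spanP.
Qed.

Fact quotmod_map_linear : linear (quotmod_map fST).
Proof.
move=> r p q; rewrite -[p]quotmod_reprK -[q]quotmod_reprK -linearP.
by rewrite !quotmod_map_proj !linearP.
Qed.

HB.instance Definition _ := GRing.isLinear.Build R (quotmod S) (quotmod T) *:%R
  (quotmod_map fST) quotmod_map_linear.

End QuotientMap.

Section Kernel.
Variables (R : comNzRingType) (U V : lmodType R) (f : {linear U -> V}).

Definition ker_pred : {pred U} := [pred x | f x == 0].

Fact ker_pred_closed : submod_closed ker_pred.
Proof.
split=> [|c x y]; rewrite !inE; first by rewrite linear0.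
by move=> /eqP fx /eqP fy; rewrite linearP fx fy scaler0 addr0.
Qed.

HB.instance Definition _ :=
  GRing.isSubmodClosed.Build R U ker_pred ker_pred_closed.

Record ker := Ker { ker_val :> U; ker_valP : ker_val \in ker_pred }.

HB.instance Definition _ := [isSub for ker_val].
HB.instance Definition _ := [Choice of ker by <:].
HB.instance Definition _ := [SubChoice_isSubLmodule of ker by <:].

End Kernel.

Section KernelMap.
Variables (R : comNzRingType) (U V U' V' : lmodType R).
Variables (f : {linear U -> V}) (f' : {linear U' -> V'}) (g : {linear U -> U'}).
Hypothesis gker : forall x, f x = 0 -> f' (g x) = 0.

Fact ker_map_subproof (x : ker f) : g (val x) \in ker_pred f'.
Proof. by rewrite inE; apply/eqP/gker/eqP; exact: (valP x). Qed.

Definition ker_map (x : ker f) : ker f' := Ker (ker_map_subproof x).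

Fact ker_map_linear : linear ker_map.
Proof. by move=> r x y; apply: val_inj; rewrite /= linearP. Qed.

HB.instance Definition _ := GRing.isLinear.Build R (ker f) (ker f') *:%R
  ker_map ker_map_linear.

End KernelMap.

Section HomModule.
Variables (R : comNzRingType) (U V : lmodType R).

Definition homMod : Type := {linear U -> V}.

HB.instance Definition _ := gen_eqMixin homMod.
HB.instance Definition _ := gen_choiceMixin homMod.

Definition hom_fun (f : homMod) : {linear U -> V} := f.

Coercion hom_fun : homMod >-> GRing.Linear.type.

Lemma homP (f g : homMod) : f =1 g -> f = g.
Proof.
rewrite /hom_fun => fg; have {fg} : (f : U -> V) = g by exact: funext.
case: f g => f [[fa] [fs]] [g [[ga] [gs]]] /= fg; move: fa fs ga gs.
rewrite {}fg => fa fs ga gs.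
by rewrite (Prop_irrelevance fa ga) (Prop_irrelevance fs gs).
Qed.

Fact scale_hom_linear (r : R) (f : homMod) : linear (r \*: f).
Proof. by move=> c x y /=; rewrite linearP scalerDr !scalerA mulrC. Qed.

Definition hom0 : homMod := (\0 : {linear U -> V}).
Definition hom_add (f g : homMod) : homMod := (f \+ g : {linear U -> V}).
Definition hom_opp (f : homMod) : homMod := (\- f : {linear U -> V}).
Definition hom_scale (r : R) (f : homMod) : homMod :=
  HB.pack_for {linear U -> V} (r \*: f)
    (GRing.isLinear.Build R U V *:%R (r \*: f) (scale_hom_linear r f)).

Fact hom_addA : associative hom_add.
Proof. by move=> f g h; apply: homP => x /=; rewrite addrA. Qed.

Fact hom_addC : commutative hom_add.
Proof. by move=> f g; apply: homP => x /=; rewrite addrC. Qed.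

Fact hom_add0 : left_id hom0 hom_add.
Proof. by move=> f; apply: homP => x /=; rewrite add0r. Qed.

Fact hom_addN : left_inverse hom0 hom_opp hom_add.
Proof. by move=> f; apply: homP => x /=; rewrite addNr. Qed.

HB.instance Definition _ :=
  GRing.isZmodule.Build homMod hom_addA hom_addC hom_add0 hom_addN.

Fact hom_scaleA r s f : hom_scale r (hom_scale s f) = hom_scale (r * s) f.
Proof. by apply: homP => x /=; rewrite scalerA. Qed.

Fact hom_scale1 : left_id 1 hom_scale.
Proof. by move=> f; apply: homP => x /=; rewrite scale1r. Qed.

Fact hom_scaleDr : right_distributive hom_scale +%R.
Proof. by move=> r f g; apply: homP => x /=; rewrite scalerDr. Qed.

Fact hom_scaleDl f : {morph hom_scale^~ f : r s / r + s}.
Proof. by move=> r s; apply: homP => x /=; rewrite scalerDl. Qed.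

HB.instance Definition _ := GRing.Zmodule_isLmodule.Build R homMod
  hom_scaleA hom_scale1 hom_scaleDr hom_scaleDl.

End HomModule.

Section Precomposition.
Variables (R : comNzRingType) (U U' V : lmodType R) (g : {linear U -> U'}).

Definition hom_comp (f : homMod U' V) : homMod U V := (f \o g : {linear U -> V}).

Fact hom_comp_linear : linear hom_comp.
Proof. by move=> r f f'; apply: homP. Qed.

HB.instance Definition _ := GRing.isLinear.Build R (homMod U' V) (homMod U V) *:%R
  hom_comp hom_comp_linear.

End Precomposition.

Section FreeModule.
Variables (R : comNzRingType) (T : choiceType) (V : lmodType R) (f : T -> V).

Definition free_lift (g : {malg R[T]}) : V := \sum_(t <- msupp g) g@_t *: f t.

Lemma free_liftEw (g : {malg R[T]}) (D : {fset T}) : (msupp g `<=` D)%fset ->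
  free_lift g = \sum_(t <- D) g@_t *: f t.
Proof.
move=> gD; rewrite /free_lift (big_fset_incl _ gD) // => t _ /mcoeff_outdom ->.
by rewrite scale0r.
Qed.

Fact free_lift_linear : linear free_lift.
Proof.
move=> r x y; pose D := (msupp x `|` msupp y `|` msupp (r *: x + y))%fset.
rewrite !(@free_liftEw _ D);
  try by apply/fsubsetP => t tD; rewrite !in_fsetU tD ?orbT.
rewrite scaler_sumr -big_split /=; apply: eq_bigr => t _.
by rewrite mcoeffD mcoeffZ scalerDl scalerA.
Qed.

HB.instance Definition _ :=
  GRing.isLinear.Build R {malg R[T]} V *:%R free_lift free_lift_linear.

Lemma free_liftU t : free_lift << t >> = f t.
Proof. by rewrite /free_lift msuppU oner_eq0 big_seq_fset1 mcoeffUU scale1r. Qed.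

End FreeModule.

(* The functorial free resolution
     ... -> R^(N_2) -> R^(N_1) -> R^(N_0) -> N -> 0,   N_0 = N,
   where R^(T) = {malg R[T]} is the free module with basis T and N_(i+1) is the
   kernel of the canonical surjection R^(N_i) -> N_i. *)
Section FreeResolution.
Variable R : comNzRingType.
Implicit Types N : lmodType R.

Definition free_cover (N : lmodType R) : {linear {malg R[N]} -> N} :=
  free_lift (@idfun N).

Fixpoint syzygy (N : lmodType R) (i : nat) : lmodType R :=
  if i is j.+1 then ker (free_cover (syzygy N j)) else N.

Definition res_term N i : lmodType R := {malg R[syzygy N i]}.

Definition res_diff N i : {linear res_term N i.+1 -> res_term N i} :=
  (val : ker (free_cover (syzygy N i)) -> res_term N i)
    \o free_cover (syzygy N i.+1).

Lemma free_cover_surj N (x : N) : exists g, free_cover N g = x.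
Proof. by exists << x >>; exact: free_liftU. Qed.

Lemma res_exact0 N (g : res_term N 0) :
  free_cover N g = 0 <-> exists h, res_diff N 0 h = g.
Proof.
split=> [g0|[h <-]]; last by apply/eqP; exact: (valP (free_cover _ h)).
have gP : g \in ker_pred (free_cover N) by rewrite inE g0.
by have [h hE] := @free_cover_surj (syzygy N 1) (Ker gP); exists h; rewrite /= hE.
Qed.

Lemma res_exact N i (g : res_term N i.+1) :
  res_diff N i g = 0 <-> exists h, res_diff N i.+1 h = g.
Proof.
split=> [g0|[h <-]]; last first.
  apply: (congr1 val (y := 0)); apply/eqP; exact: (valP (free_cover _ h)).
have gP : g \in ker_pred (free_cover (syzygy N i.+1)).
  by rewrite inE; apply/eqP/val_inj.
by have [h hE] := @free_cover_surj (syzygy N i.+2) (Ker gP); exists h; rewrite /= hE.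
Qed.

Section Functoriality.
Variables (N N' : lmodType R).

Definition free_map (f : {linear N -> N'}) : {linear {malg R[N]} -> {malg R[N']}} :=
  free_lift (fun x => << f x >> : {malg R[N']}).

Lemma free_cover_map f g : free_cover N' (free_map f g) = f (free_cover N g).
Proof.
have -> : free_cover N g = \sum_(x <- msupp g) g@_x *: x by [].
have -> : free_map f g = \sum_(x <- msupp g) g@_x *: << f x >> by [].
rewrite !linear_sum.
apply: eq_bigr => x _; rewrite !linearZ /=; congr (_ *: _).
exact: free_liftU.
Qed.

Fact free_map_ker f g : free_cover N g = 0 -> free_cover N' (free_map f g) = 0.
Proof. by rewrite free_cover_map => ->; rewrite linear0. Qed.

End Functoriality.

Fixpoint syzygy_map (N N' : lmodType R) (f : {linear N -> N'}) i :
    {linear syzygy N i -> syzygy N' i} :=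
  if i is j.+1 then ker_map (free_map_ker (syzygy_map f j)) else f.

Definition res_map N N' (f : {linear N -> N'}) i :
  {linear res_term N i -> res_term N' i} := free_map (syzygy_map f i).

Lemma res_diff_map N N' (f : {linear N -> N'}) i g :
  res_diff N' i (res_map f i.+1 g) = res_map f i (res_diff N i g).
Proof. by rewrite /= free_cover_map. Qed.

End FreeResolution.

(* Ext i N X is the i-th cohomology of Hom_R(res_term N, X). *)
Section Ext.
Variable R : comNzRingType.
Implicit Types N X : lmodType R.

Definition ext_cochain_map N N' X (f : {linear N -> N'}) i :
    {linear homMod (res_term N' i) X -> homMod (res_term N i) X} :=
  @hom_comp R _ _ X (res_map f i).

Definition ext_diff N X i :
    {linear homMod (res_term N i) X -> homMod (res_term N i.+1) X} :=
  @hom_comp R _ _ X (res_diff N i).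

Definition ext_cocycle N X i : lmodType R := ker (ext_diff N X i).

Definition ext_coboundary N X i : set (ext_cocycle N X i) :=
  if i is j.+1 then
    [set z : ext_cocycle N X j.+1 | exists c, val z = ext_diff N X j c]
  else [set 0].

Definition Ext i N X : lmodType R := quotmod (@ext_coboundary N X i).

Lemma ext_cochain_mapC N N' X (f : {linear N -> N'}) i c :
  ext_diff N X i (ext_cochain_map X f i c) =
  ext_cochain_map X f i.+1 (ext_diff N' X i c).
Proof. by apply: homP => x /=; congr (c _); exact: esym (res_diff_map f x). Qed.

Fact ext_cocycle_subproof N N' X (f : {linear N -> N'}) i c :
  ext_diff N' X i c = 0 -> ext_diff N X i (ext_cochain_map X f i c) = 0.
Proof. by rewrite ext_cochain_mapC => ->; rewrite linear0. Qed.

Definition ext_cocycle_map N N' X (f : {linear N -> N'}) i :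
    {linear ext_cocycle N' X i -> ext_cocycle N X i} :=
  ker_map (@ext_cocycle_subproof N N' X f i).

Fact ext_coboundary_subproof N N' X (f : {linear N -> N'}) i z :
  ext_coboundary z -> span (@ext_coboundary N X i) (@ext_cocycle_map N N' X f i z).
Proof.
move=> zB; apply: sub_gen_smallest; case: i z zB => [|i] z.
  by move=> ->; rewrite /= linear0.
move=> [c zc]; exists (ext_cochain_map X f i c).
by rewrite ext_cochain_mapC -zc.
Qed.

Definition Ext_map i N N' X (f : {linear N -> N'}) :
    {linear Ext i N' X -> Ext i N X} :=
  quotmod_map (@ext_coboundary_subproof N N' X f i).

End Ext.

(* The direct limit of modules E_k (k : nat) along phi k l : E_k -> E_l, k <= l:
   the quotient of the direct sum of the E_k by the submodule generated by the
   x - phi k l x.  The direct sum is itself presented as the free module on the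
   pairs (k, x), x in E_k, modulo the linearity of each x |-> (k, x). *)
Section DirectLimit.
Variables (R : comNzRingType) (E : nat -> lmodType R).
Variable phi : forall k l : nat, (k <= l)%N -> {linear E k -> E l}.

Definition dirlim_gen k (x : E k) : {malg R[{k : nat & E k}]} :=
  << Tagged (fun k => E k) x >>.

Definition dirlim_rel : set {malg R[{k : nat & E k}]} :=
  [set g | exists k r (x y : E k), g =
     dirlim_gen (r *: x + y) - (r *: dirlim_gen x + dirlim_gen y)] `|`
  [set g | exists k l (kl : (k <= l)%N) (x : E k),
     g = dirlim_gen x - dirlim_gen (phi kl x)].

Definition dirlim : lmodType R := quotmod dirlim_rel.

End DirectLimit.

Arguments dirlim_gen {R} E k x.

Section LocalCohomology.
Variables (R : comNzRingType) (a : set R).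
Implicit Types M X : lmodType R.

Definition power_quot M k : lmodType R :=
  quotmod (ideal_mul (ideal_exp a k) [set: M]).

Lemma ideal_exp_le k l : (k <= l)%N -> ideal_exp a l `<=` ideal_exp a k.
Proof.
elim: k l => [|k IH] l; first by move=> _ x.
case: l => // l kl; apply: (@span_mono R R^o).
by apply: image2_subset => //; exact: IH.
Qed.

Fact power_quot_subproof M k l : (k <= l)%N ->
  forall x : M, ideal_mul (ideal_exp a l) [set: M] x ->
    span (ideal_mul (ideal_exp a k) [set: M]) x.
Proof.
move=> kl x xl; apply: sub_gen_smallest; move: x xl; apply: span_mono.
by apply: image2_subset => //; exact: ideal_exp_le.
Qed.

Definition power_quot_proj M k l (kl : (k <= l)%N) :
    {linear power_quot M l -> power_quot M k} :=
  quotmod_map (f := @idfun M) (@power_quot_subproof M k l kl).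

Definition gen_loc_cohom i M X : lmodType R :=
  dirlim (fun k l kl => Ext_map i X (@power_quot_proj M k l kl)).

End LocalCohomology.

(* Main.v *)
From HB Require Import structures.
From mathcomp Require Import all_boot all_algebra.
From mathcomp Require Import boolp classical_sets functions.
From mathcomp Require Import monalg.
Require Import Defs.

(** Write [T = M / aM] and [N_k = M / a^k M], so that [H^i = colim_k Ext^i(N_k, X)].

    Call a finitely generated module [N] supported on [T] when every prime
    containing [Ann N] contains [Ann T]; this class contains all the [N_k] and
    is stable under submodules and quotients, because [R] is Noetherian.
    Suppose that [Ext^j(-, X)] vanishes on the class for all [j < i].  Then
    [Ext^i(-, X)] turns surjections between modules of the class into
    injections ([Ext_map_inj_supported]), for the only obstruction is
    [Ext^(i-1)] of the kernel.  Three consequences carry the proof.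

    - The transition maps of the colimit are injective, so [Ext^i(N_k, X)]
      embeds in [H^i] ([loc_class_inj]).

    - If moreover [Ext^i(T, X) = 0], then [Ext^i(-, X)] vanishes on the whole
      class ([ext_vanish_supported]).  Filtering by cyclic modules reduces to
      [N = R/J], which Noetherian induction on [J] settles: if [J] is not
      prime, [R/J] is an extension of two cyclic modules with larger
      annihilators; if [J] is prime, there is a nonzero map [f : T -> R/J]
      ([nonzero_map]), its cokernel is covered by the induction, and a class of
      [Ext^i(R/J, X)] dies on [T], hence on the image of [f], hence comes from
      the cokernel.  Since [H^i = 0] forces [Ext^i(T, X) = 0] when [i < n], an
      induction on [i] gives the vanishing in all degrees [j < n]
      ([low_vanish_of_loc_cohom]).

    - A class [x] of [Ext^n(N_k, X)] killed by [a] comes from [Ext^n(T, X)]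
      ([ext_power_quot_killed]): if [r x = 0], then [x] dies along
      multiplication by [r], hence on [r N_k], hence comes from
      [N_k / r N_k], and one divides out the generators of [a] one by one.

    In degree [n], [Ext^n(T, X)] and all the [Ext^n(N_k, X)] embed in [H^n], so
    the associated primes of [Ext^n(T, X)] are among those of [H^n].
    Conversely, if [p] is the annihilator of a class of [Ext^n(N_k, X)], then
    [a] is contained in [p], because [a^k] kills [N_k] and [p] is prime; so this
    class comes from [Ext^n(T, X)] and [p] is an associated prime there.

    Two parts of the long exact sequence of [Ext] and the action of scalars are
    established by dimension shifting along [Ext^(i+1)(N) = Ext^i(Omega N)], for
    a shift to the first syzygy [Omega N] turns a short exact sequence into
    another one, up to maps that factor through free modules
    ([middle_exact_Omega], [pnull_inj], [fmap_additive]). *)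

Set Implicit Arguments.
Unset Strict Implicit.
Unset Printing Implicit Defensive.

Import GRing.Theory.
Local Open Scope ring_scope.
Local Open Scope classical_set_scope.

(** * Linear maps, kernels and free modules *)

Section LinearMaps.
Variable R : comNzRingType.
Implicit Types U V W : lmodType R.

Definition onto U V (g : U -> V) := forall y, exists x, g x = y.

Lemma linear_exists U V (f : U -> V) :
  linear f -> exists g : {linear U -> V}, forall x, g x = f x.
Proof.
move=> lin_f; unshelve eexists.
  exact: (HB.pack_for {linear U -> V} f (GRing.isLinear.Build R U V *:%R f lin_f)).
by [].
Qed.

Lemma factor_surj U V W (g : {linear U -> V}) (c : {linear U -> W}) :
  onto g -> (forall x, g x = 0 -> c x = 0) ->
  exists c' : {linear V -> W}, forall x, c' (g x) = c x.
Proof.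
move=> /choice[s sK] kgc.
have cE x y : g x = g y -> c x = c y.
  by move=> gxy; apply/subr0_eq; rewrite -linearB kgc // linearB gxy subrr.
have [|c' c'E] := @linear_exists V W (c \o s).
  by move=> r y z; rewrite /= -linearP; apply: cE; rewrite linearP !sK.
by exists c' => x; rewrite c'E; apply: cE.
Qed.

(** The module [ker g] behind a name that unification does not unfold. *)
Definition kmod U V (g : {linear U -> V}) : lmodType R := ker g.

Definition ker_incl U V (g : {linear U -> V}) : {linear kmod g -> U} :=
  (val : ker g -> U).

Lemma ker_incl0 U V (g : {linear U -> V}) z : g (ker_incl g z) = 0.
Proof. exact/eqP/(valP (z : ker g)). Qed.

Lemma ker_incl_inj U V (g : {linear U -> V}) : injective (ker_incl g).
Proof. exact: val_inj. Qed.

Lemma ker_incl_onto U V (g : {linear U -> V}) x :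
  g x = 0 -> exists z, ker_incl g z = x.
Proof.
by move=> gx0; have gx0P : x \in ker_pred g; [rewrite inE gx0|exists (Ker gx0P)].
Qed.

Lemma ker_lift U V W (g : {linear V -> W}) (f : {linear U -> V}) :
  (forall x, g (f x) = 0) ->
  exists f' : {linear U -> kmod g}, forall x, ker_incl g (f' x) = f x.
Proof.
move=> gf0; have gf0P x : f x \in ker_pred g by rewrite inE gf0.
have [|f' f'E] := @linear_exists U (kmod g) (fun x => Ker (gf0P x)).
  by move=> r x y; apply: val_inj; rewrite /= linearP.
by exists f' => x; rewrite f'E.
Qed.

Lemma free_linear_ext (T : choiceType) V (f g : {linear {malg R[T]} -> V}) :
  (forall t, f << t >> = g << t >>) -> f =1 g.
Proof.
move=> fg x; rewrite [x]monalgE !linear_sum; apply: eq_bigr => t _.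
have -> : << x@_t *g t >> = x@_t *: << t >> :> {malg R[T]}.
  by apply/malgP => k; rewrite mcoeffZ !mcoeffU mulrnAr mulr1.
by rewrite !linearZ /= fg.
Qed.

Lemma free_liftP (T : choiceType) U V (p : {linear U -> V})
    (f : {linear {malg R[T]} -> V}) :
  onto p -> exists f' : {linear {malg R[T]} -> U}, forall x, p (f' x) = f x.
Proof.
move=> /choice[s sK]; exists (free_lift (fun t => s (f << t >>))).
apply: (@free_linear_ext T V (p \o free_lift (fun t => s (f << t >>)))) => t /=.
by rewrite free_liftU sK.
Qed.

Lemma linear_comb U V r (f g : {linear U -> V}) :
  exists h : {linear U -> V}, forall x, h x = r *: f x + g x.
Proof.
apply: linear_exists => c x y; rewrite /= (linearP f) (linearP g).
rewrite scalerDr !scalerDr !scalerA (mulrC r c).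
by rewrite -!addrA; congr (_ + _); rewrite addrCA.
Qed.

End LinearMaps.
Arguments onto {R U V} g.
Arguments kmod : simpl never.
Arguments ker_incl : simpl never.
(* Unifying a kernel with another module by unfolding both records of
   operations is very slow; from here on kernels are used through the four
   lemmas on [ker_incl]. *)
Local Opaque kmod ker_incl.

(** * Iterated syzygies and null classes *)

Section Syzygies.
Variable R : comNzRingType.
Implicit Types U N P K : lmodType R.

Definition Omega N : lmodType R := kmod (free_cover N).

Definition Omega_map N N' (f : {linear N -> N'}) : {linear Omega N -> Omega N'} :=
  ker_map (free_map_ker f).

Definition cover_incl N : {linear Omega N -> {malg R[N]}} :=
  ker_incl (free_cover N).

(** The [i]-th syzygy computed from the front: the first step replaces [N] by
    its first syzygy.  Dimension shifting [Ext^(i+1)(N) = Ext^i(Omega N)] then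
    holds by computation, which it would not for [syzygy]. *)
Fixpoint fsyz i N : lmodType R := if i is j.+1 then fsyz j (Omega N) else N.

Fixpoint fmap i N N' (f : {linear N -> N'}) {struct i} :
    {linear fsyz i N -> fsyz i N'} :=
  if i is j.+1 then fmap j (Omega_map f) else f.

Lemma free_mapU N N' (f : {linear N -> N'}) x :
  free_map f << x >> = << f x >> :> {malg R[N']}.
Proof. exact: free_liftU. Qed.

Lemma free_coverU N (x : N) : free_cover N << x >> = x.
Proof. exact: free_liftU. Qed.

Lemma cover_incl0 N (z : Omega N) : free_cover N (cover_incl N z) = 0.
Proof. exact: ker_incl0. Qed.

Lemma cover_incl_inj N : injective (cover_incl N).
Proof. exact: ker_incl_inj. Qed.

Lemma cover_incl_map N N' (f : {linear N -> N'}) z :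
  cover_incl N' (Omega_map f z) = free_map f (cover_incl N z).
Proof. by []. Qed.

Lemma cover_incl_onto N x : free_cover N x = 0 -> exists z, cover_incl N z = x.
Proof. exact: ker_incl_onto. Qed.

Lemma Omega_lift U N (f : {linear U -> {malg R[N]}}) :
  (forall x, free_cover N (f x) = 0) ->
  exists f' : {linear U -> Omega N}, forall x, cover_incl N (f' x) = f x.
Proof. exact: ker_lift. Qed.

End Syzygies.
Arguments fsyz : simpl never.
Arguments fmap : simpl never.
Arguments Omega : simpl never.
Arguments Omega_map : simpl never.
Arguments cover_incl : simpl never.
Arguments free_cover : simpl never.
Arguments free_map : simpl never.

Section SyzygyFunctor.
Variable R : comNzRingType.
Implicit Types N : lmodType R.

Lemma Omega_map_comp N1 N2 N3 (f : {linear N1 -> N2}) (g : {linear N2 -> N3})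
    (h : {linear N1 -> N3}) :
  (forall x, h x = g (f x)) -> forall x, Omega_map h x = Omega_map g (Omega_map f x).
Proof.
move=> hE x; apply: cover_incl_inj; rewrite !cover_incl_map.
apply: (free_linear_ext (g := free_map g \o free_map f)) => t /=.
by rewrite !free_mapU hE.
Qed.

Lemma Omega_map_id N (f : {linear N -> N}) :
  (forall x, f x = x) -> forall x, Omega_map f x = x.
Proof.
move=> fE x; apply: cover_incl_inj; rewrite cover_incl_map.
by apply: (free_linear_ext (g := idfun)) => t; rewrite free_mapU fE.
Qed.

Lemma fmap_comp i N1 N2 N3 (f : {linear N1 -> N2}) (g : {linear N2 -> N3})
    (h : {linear N1 -> N3}) :
  (forall x, h x = g (f x)) -> forall x, fmap i h x = fmap i g (fmap i f x).
Proof.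
elim: i N1 N2 N3 f g h => [//|i IH] N1 N2 N3 f g h hE.
exact: (IH _ _ _ (Omega_map f) (Omega_map g) (Omega_map h) (Omega_map_comp hE)).
Qed.

Lemma fmap_id i N (f : {linear N -> N}) :
  (forall x, f x = x) -> forall x, fmap i f x = x.
Proof.
elim: i N f => [//|i IH] N f fE; exact: (IH _ (Omega_map f) (Omega_map_id fE)).
Qed.

End SyzygyFunctor.

Section NullClasses.
Variables (R : comNzRingType) (X : lmodType R).
Implicit Types A B C N P K : lmodType R.

(** A class in [Ext^i(N, X)] is represented by a linear map on the [i]-th
    syzygy of [N].  For [i > 0] it is zero when this map extends to the free
    module that contains the syzygy; [pnull] says so in degree [i.+1], and
    shifts the degree down until the free module is [R^(N)]. *)
Fixpoint pnull (i : nat) (N : lmodType R) {struct i} :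
    (fsyz i.+1 N -> X) -> Prop :=
  match i return (fsyz i.+1 N -> X) -> Prop with
  | 0 => fun phi => exists psi : {linear {malg R[N]} -> X},
      forall z : Omega N, phi z = psi (cover_incl N z)
  | j.+1 => fun phi => @pnull j (Omega N) phi
  end.

Definition null i N : (fsyz i N -> X) -> Prop :=
  if i is j.+1 return (fsyz i N -> X) -> Prop then @pnull j N
  else fun phi => forall x, phi x = 0.

Definition all_null i N := forall phi : {linear fsyz i N -> X}, null phi.

Lemma pnull_ext i N (phi psi : fsyz i.+1 N -> X) :
  phi =1 psi -> pnull phi -> pnull psi.
Proof. by move/funext->. Qed.

Lemma pnullP i N r (phi psi : fsyz i.+1 N -> X) :
  pnull phi -> pnull psi -> pnull (fun x => r *: phi x + psi x).
Proof.
elim: i N phi psi => [|i IH] N phi psi; last exact: (IH (Omega N) phi psi).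
move=> [f fE] [g gE].
have [h hE] := linear_comb r f g.
by exists h => z; rewrite hE fE gE.
Qed.

Lemma pnullD i N (phi psi : fsyz i.+1 N -> X) :
  pnull phi -> pnull psi -> pnull (fun x => phi x + psi x).
Proof.
move=> phi0 psi0; apply: pnull_ext (pnullP 1 phi0 psi0) => x.
by rewrite scale1r.
Qed.

Lemma pnullB i N (phi psi : fsyz i.+1 N -> X) :
  pnull phi -> pnull psi -> pnull (fun x => phi x - psi x).
Proof.
move=> phi0 psi0; apply: pnull_ext (pnullP (-1) psi0 phi0) => x.
by rewrite scaleN1r addrC.
Qed.

Lemma pnull_pull i N N' (f : {linear N -> N'}) (phi : fsyz i.+1 N' -> X) :
  pnull phi -> pnull (fun x => phi (fmap i.+1 f x)).
Proof.
elim: i N N' f phi => [|i IH] N N' f phi.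
  2: exact: (IH (Omega N) (Omega N') (Omega_map f) phi).
by move=> [psi psiE]; exists (psi \o free_map f) => z; rewrite psiE.
Qed.

(** Splitting of the canonical surjection [R^(P) -> P], a characterization of
    projective modules that involves no other module. *)
Definition projective P := exists s : {linear P -> {malg R[P]}},
  forall x, free_cover P (s x) = x.

Lemma free_projective (T : choiceType) : projective {malg R[T]}.
Proof.
exists (free_lift (fun t => << << t >> >>)) => x.
apply: (free_linear_ext (f := free_cover {malg R[T]} \o _) (g := idfun)) => t /=.
by rewrite free_liftU; exact: free_liftU.
Qed.

Lemma projective_Omega P : projective P ->
  exists rho : {linear {malg R[P]} -> Omega P}, forall z, rho (cover_incl P z) = z.
Proof.
move=> [s sK].
have [|rho rhoE] := @Omega_lift R _ P (idfun \- (s \o free_cover P)).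
  by move=> x; rewrite /= linearB /= sK subrr.
exists rho => z; apply: cover_incl_inj; rewrite rhoE /=.
by rewrite cover_incl0 linear0 subr0.
Qed.

(** The cover of a projective module splits, so [Omega P] is a direct summand of
    a free module. *)
Lemma Omega_projective P : projective P -> projective (Omega P).
Proof.
move=> /projective_Omega[rho rhoK].
have [|l lE] := @free_liftP R P {malg R[Omega P]} (Omega P) (free_cover (Omega P)) rho.
  exact: free_cover_surj.
by exists (l \o cover_incl P) => z /=; rewrite lE rhoK.
Qed.

(** The higher [Ext] of a projective module vanish: a map on [Omega P] extends
    through the retraction of [R^(P)] onto [Omega P], and [Omega P] is again
    projective. *)
Lemma projective_all_null i P : projective P -> all_null i.+1 P.
Proof.
elim: i P => [|i IH] P projP phi; last exact: (IH (Omega P) (Omega_projective projP) phi).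
have [rho rhoK] := projective_Omega projP.
by exists (phi \o rho) => z /=; rewrite rhoK.
Qed.

(** A map that factors through a free module induces zero on the higher [Ext]. *)
Lemma pnull_through_free i N N' (T : choiceType) (a : {linear N -> {malg R[T]}})
  (b : {linear {malg R[T]} -> N'}) (u : {linear N -> N'})
  (phi : {linear fsyz i.+1 N' -> X}) :
  (forall x, u x = b (a x)) -> pnull (fun x => phi (fmap i.+1 u x)).
Proof.
move=> uE; have := projective_all_null (free_projective T) (phi \o fmap i.+1 b).
move=> /(pnull_pull a); apply: pnull_ext => x /=; congr (phi _).
exact/esym/(@fmap_comp R i.+1 _ _ _ a b u uE).
Qed.

(** [free_map] is not additive, but its defect of additivity covers zero, so it
    lands in [Omega N']. *)
Lemma free_map_additive N N' r (h f g : {linear N -> N'}) :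
  (forall x, h x = r *: f x + g x) ->
  exists u : {linear {malg R[N]} -> Omega N'}, forall x,
    cover_incl N' (u x) = free_map h x - (r *: free_map f x + free_map g x).
Proof.
move=> hE; have [k kE] := linear_comb r (free_map f) (free_map g).
have [|u uE] := @Omega_lift R _ N' (free_map h \- k).
  move=> x /=; rewrite linearB free_cover_map hE kE.
  rewrite [free_cover N' (_ + _)]linearD [free_cover N' (_ *: _)]linearZ /=.
  by rewrite !free_cover_map subrr.
by exists u => x; rewrite uE /= kE.
Qed.

(** [Ext] is additive and [R]-linear in the map: by [free_map_additive], the
    failure of [Omega_map] to be linear in [f] factors through [R^(N)], so it is
    invisible to [Ext]. *)
Lemma fmap_additive i N N' r (h f g : {linear N -> N'})
    (phi : {linear fsyz i.+1 N' -> X}) :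
  (forall x, h x = r *: f x + g x) ->
  pnull (fun x => phi (fmap i.+1 h x) -
    (r *: phi (fmap i.+1 f x) + phi (fmap i.+1 g x))).
Proof.
elim: i N N' r h f g phi => [|i IH] N N' r h f g phi hE;
  have [u uE] := free_map_additive hE.
  exists (phi \o u) => z /=; rewrite -linearZ -linearD -linearB; congr (phi _).
  apply: cover_incl_inj; rewrite uE linearB linearD linearZ.
  by rewrite !cover_incl_map.
have [g' g'E] := linear_comb 1 (u \o cover_incl N) (Omega_map g).
have hE' z : Omega_map h z = r *: Omega_map f z + g' z.
  apply: cover_incl_inj; rewrite g'E /= scale1r !linearD linearZ /=.
  by rewrite uE !cover_incl_map addrCA subrK.
have v0 := @pnull_through_free i _ _ _ (cover_incl N) u (u \o cover_incl N) phi (fun=> erefl).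
have h0 := IH (Omega N) (Omega N') _ _ _ _ phi hE'.
have g0 := IH (Omega N) (Omega N') _ _ _ _ phi g'E.
have := pnullD h0 (pnullD g0 v0).
apply: pnull_ext => x /=; rewrite scale1r.
by rewrite !opprD -!addrA; congr (_ + (_ + _)); rewrite addKr addrC addrK.
Qed.
End NullClasses.

(** * Short exact sequences of syzygies *)

Section RelativeSyzygies.
Variables (R : comNzRingType) (X : lmodType R).
Implicit Types A B C N P K : lmodType R.

(** A split surjection [p] induces an injection on [Ext]. *)
Lemma pnull_split i N K (p : {linear K -> N}) (s : {linear N -> K})
    (phi : fsyz i.+1 N -> X) :
  (forall x, p (s x) = x) -> pnull (fun z => phi (fmap i.+1 p z)) -> pnull phi.
Proof.
move=> sK /(pnull_pull s); apply: pnull_ext => x; congr phi.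
rewrite -(@fmap_comp R i.+1 _ _ _ s p (p \o s)) //.
exact: fmap_id.
Qed.

(** The kernel of [R^(B) -> B -> C], a first syzygy of [C] computed with the
    cover of [B].  It fits in the two short exact sequences
    [0 -> Omega B -> rsyz g -> ker g -> 0] and
    [0 -> Omega (ker g) -> Omega B * R^(ker g) -> rsyz g -> 0],
    which shift exactness for [0 -> ker g -> B -> C -> 0] down by one degree. *)
Section RelativeSyzygy.
Variables (B C : lmodType R) (g : {linear B -> C}).

Definition rsyz : lmodType R := kmod (g \o free_cover B).

Definition rsyz_incl : {linear rsyz -> {malg R[B]}} := ker_incl (g \o free_cover B).

Lemma rsyz_incl0 z : g (free_cover B (rsyz_incl z)) = 0.
Proof. exact: (@ker_incl0 _ _ _ (g \o free_cover B) z). Qed.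

Lemma rsyz_incl_inj : injective rsyz_incl.
Proof. exact: ker_incl_inj. Qed.

Lemma rsyz_lift (U : lmodType R) (f : {linear U -> {malg R[B]}}) :
  (forall x, g (free_cover B (f x)) = 0) ->
  exists f' : {linear U -> rsyz}, forall x, rsyz_incl (f' x) = f x.
Proof. exact: (@ker_lift R U _ _ (g \o free_cover B)). Qed.

End RelativeSyzygy.
Arguments rsyz : simpl never.
Arguments rsyz_incl : simpl never.
Local Opaque rsyz rsyz_incl.

(** [rsyz g] and [Omega C] have the same [Ext]: [p] and [s] satisfy [p s = id],
    and [s p - id] factors through [R^(B)].  They are induced by
    [free_map g] and by a section [s0] of it. *)
Lemma rsyz_Omega B C (g : {linear B -> C}) (g_onto : onto g) :
  exists (j : {linear Omega B -> rsyz g}) (p : {linear rsyz g -> Omega C})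
      (s : {linear Omega C -> rsyz g}) (w : {linear {malg R[B]} -> rsyz g})
      (s0 : {linear {malg R[C]} -> {malg R[B]}}),
    [/\ forall z, rsyz_incl g (j z) = cover_incl B z,
        forall z, p (j z) = Omega_map g z,
        forall z, p (s z) = z,
        forall z, s (p z) = z + w (rsyz_incl g z) &
        forall z, rsyz_incl g (s z) = s0 (cover_incl C z)].
Proof.
have fg_onto : onto (free_map g).
  have /choice[t tK] := g_onto.
  move=> y; exists (free_lift (fun c => << t c >>) y).
  apply: (free_linear_ext (f := free_map g \o _) (g := idfun)) => c /=.
  by rewrite free_liftU free_mapU tK.
(* Free modules are projective: a section of [R^(B) -> R^(C)]. *)
have [s0 s0K] := free_liftP idfun fg_onto.
have [|j jE] := @rsyz_lift B C g _ (cover_incl B).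
  by move=> x; rewrite cover_incl0 linear0.
have [|p pE] := @Omega_lift R _ C (free_map g \o rsyz_incl g).
  by move=> x /=; rewrite free_cover_map rsyz_incl0.
have cs0 x : g (free_cover B (s0 x)) = free_cover C x.
  by rewrite -free_cover_map s0K.
have [|s sE] := @rsyz_lift B C g _ (s0 \o cover_incl C).
  by move=> x /=; rewrite cs0 cover_incl0.
have [|w wE] := @rsyz_lift B C g _ ((s0 \o free_map g) \- idfun).
  by move=> x /=; rewrite !linearB /= cs0 free_cover_map subrr.
exists j, p, s, w, s0; split => //.
- by move=> z; apply: cover_incl_inj; rewrite pE /= jE.
- by move=> z; apply: cover_incl_inj; rewrite pE /= sE /= s0K.
- move=> z; apply: rsyz_incl_inj; rewrite linearD sE wE /= pE /=.
  by rewrite addrCA subrr addr0.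
Qed.

(** The second sequence: [q] sends [(b, a)] to the sum of [b] and of the image of
    [a], and its kernel consists of the pairs [(z, - z)] with [z] in
    [Omega (ker g)]. *)
Lemma ker_pair_cover B C (g : {linear B -> C})
    (j : {linear Omega B -> rsyz g}) :
  (forall z, rsyz_incl g (j z) = cover_incl B z) ->
  exists (q : {linear (Omega B * {malg R[kmod g]})%type -> rsyz g})
      (e : {linear kmod q -> Omega (kmod g)}),
    [/\ onto q, forall b, q (b, 0) = j b,
        forall z, (ker_incl q z).1 = Omega_map (ker_incl g) (e z) &
        forall z, (ker_incl q z).2 = - cover_incl (kmod g) (e z)].
Proof.
move=> jE.
have [|l lE] := @rsyz_lift B C g _ (free_map (ker_incl g)).
  by move=> x; rewrite free_cover_map; exact: ker_incl0.
have [pr1 pr1E] := @linear_exists R (Omega B * {malg R[kmod g]})%type _ fst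
  (fun _ _ _ => erefl).
have [pr2 pr2E] := @linear_exists R (Omega B * {malg R[kmod g]})%type _ snd
  (fun _ _ _ => erefl).
have [q qE'] := linear_comb 1 (j \o pr1) (l \o pr2).
have qE x : q x = j x.1 + l x.2 by rewrite qE' /= scale1r pr1E pr2E.
have qI x : rsyz_incl g (q x) = cover_incl B x.1 + free_map (ker_incl g) x.2.
  by rewrite qE linearD jE lE.
pose e0 : {linear kmod q -> _} := \- (pr2 \o ker_incl q).
have e0E z : e0 z = - (ker_incl q z).2 by rewrite -pr2E.
have qz z : cover_incl B (ker_incl q z).1 = - free_map (ker_incl g) (ker_incl q z).2.
  by apply/eqP; rewrite -addr_eq0 -qI; rewrite [q _]ker_incl0 linear0.
have [|e eE] := @Omega_lift R _ (kmod g) e0.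
  move=> x; rewrite e0E linearN.
  apply: ker_incl_inj; rewrite linearN linear0 -free_cover_map.
  have /(congr1 (free_cover B)) := qz x.
  by rewrite cover_incl0 linearN => <-.
exists q, e; split.
- move=> k.
  have [c cE] := ker_incl_onto (rsyz_incl0 k).
  pose a : {malg R[kmod g]} := << c >>.
  have [|b bE] := @cover_incl_onto R B (rsyz_incl g k - free_map (ker_incl g) a).
    by rewrite linearB free_cover_map free_coverU cE subrr.
  by exists (b, a); apply: rsyz_incl_inj; rewrite qI /= bE subrK.
- by move=> b; rewrite qE linear0 addr0.
- move=> z; apply: cover_incl_inj.
  by rewrite cover_incl_map eE e0E linearN qz.
- by move=> z; rewrite eE e0E opprK.
Qed.

End RelativeSyzygies.

(** * The long exact sequence for classes of cocycles *)

Section ExactSequence.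
Variables (R : comNzRingType) (X : lmodType R).
Implicit Types A B C N P K : lmodType R.

Lemma prod_linear A B :
  exists (pr1 : {linear (A * B)%type -> A}) (pr2 : {linear (A * B)%type -> B})
    (i1 : {linear A -> (A * B)%type}),
    [/\ forall x, pr1 x = x.1, forall x, pr2 x = x.2 & forall a, i1 a = (a, 0)].
Proof.
have [pr1 pr1E] := @linear_exists R (A * B)%type _ fst (fun _ _ _ => erefl).
have [pr2 pr2E] := @linear_exists R (A * B)%type _ snd (fun _ _ _ => erefl).
have [|i1 i1E] := @linear_exists R A (A * B)%type (fun a => (a, 0)).
  by move=> r x y; congr (_, _); rewrite /= scaler0 addr0.
by exists pr1, pr2, i1.
Qed.

(** Exactness of [Ext^(i+1)(C) -> Ext^(i+1)(B) -> Ext^(i+1)(ker g)] at the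
    middle term. *)
Definition middle_exact i := forall B C (g : {linear B -> C})
  (phi : {linear fsyz i.+1 B -> X}),
  onto g -> pnull (fun x => phi (fmap i.+1 (ker_incl g) x)) ->
  exists phi' : {linear fsyz i.+1 C -> X},
    pnull (fun x => phi' (fmap i.+1 g x) - phi x).

(** If [phi] on [Omega B] extends to [psi] over [R^(ker g)] after restriction to
    [Omega (ker g)], then [(b, a) |-> phi b + psi a] vanishes on the kernel of
    [q], so it descends to [rsyz g], and [s] carries it to [Omega C]. *)
Lemma middle_exact0 : middle_exact 0.
Proof.
move=> B C g phi g_onto [psi psiE].
have [j [p [s [w [s0 [jE pj ps sp sE]]]]]] := rsyz_Omega g_onto.
have [q [e [q_onto qj e1 e2]]] := ker_pair_cover jE.
have [pr1 [pr2 [i1 [pr1E pr2E i1E]]]] := prod_linear (Omega B) {malg R[kmod g]}.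
pose phi0 : {linear Omega B -> X} := phi.
have [Phi PhiE] := linear_comb 1 (phi0 \o pr1) (psi \o pr2).
have [z qz0|phi2 phi2E] := factor_surj (c := Phi) q_onto.
  have [k <-] := ker_incl_onto qz0.
  rewrite PhiE /= scale1r pr1E pr2E e1 e2 linearN.
  by rewrite -[psi _]psiE subrr.
exists (phi2 \o s); exists (phi2 \o w) => z.
rewrite -[fmap 1 g z]/(Omega_map g z) /= -pj sp linearD jE -qj phi2E PhiE /=.
by rewrite pr1E pr2E linear0 addr0 scale1r addrAC subrr add0r.
Qed.

(** The case of degree [i.+1] for the sequence
    [0 -> Omega (ker g) -> Omega B * R^(ker g) -> rsyz g -> 0] yields a class on
    [rsyz g]; this is a class on [Omega C], as the two modules differ by maps
    through a free module. *)
Lemma middle_exact_Omega i : middle_exact i ->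
  forall B C (g : {linear B -> C}) (phi : {linear fsyz i.+1 (Omega B) -> X}),
  onto g -> pnull (fun x => phi (fmap i.+1 (Omega_map (ker_incl g)) x)) ->
  exists phi' : {linear fsyz i.+1 (Omega C) -> X},
    pnull (fun x => phi' (fmap i.+1 (Omega_map g) x) - phi x).
Proof.
move=> IH B C g phi g_onto phi0.
have [j [p [s [w [s0 [jE pj ps sp sE]]]]]] := rsyz_Omega g_onto.
have [q [e [q_onto qj e1 e2]]] := ker_pair_cover jE.
have [pr1 [pr2 [i1 [pr1E pr2E i1E]]]] := prod_linear (Omega B) {malg R[kmod g]}.
have PhiK : pnull (fun x => phi (fmap i.+1 pr1 (fmap i.+1 (ker_incl q) x))).
  apply: (pnull_ext _ (pnull_pull e phi0)) => x; congr (phi _).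
  pose u := pr1 \o ker_incl q.
  rewrite -(@fmap_comp R i.+1 _ _ _ (ker_incl q) pr1 u) //.
  apply/esym; apply: (@fmap_comp R i.+1 _ _ _ e (Omega_map (ker_incl g)) u) => z.
  by rewrite /u /= pr1E e1.
have [phi2 phi2E] := IH _ _ q (phi \o fmap i.+1 pr1) q_onto PhiK.
have {phi2E} phi2E : pnull (fun x => phi2 (fmap i.+1 j x) - phi x).
  apply: pnull_ext (@pnull_pull R X i _ _ i1 _ phi2E) => x /=.
  rewrite -(@fmap_comp R i.+1 _ _ _ i1 q j) => [|b]; last by rewrite i1E qj.
  rewrite -(@fmap_comp R i.+1 _ _ _ i1 pr1 idfun) => [|b]; last first.
    by rewrite pr1E i1E.
  by rewrite fmap_id.
exists (phi2 \o fmap i.+1 s).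
pose spj := s \o (p \o j); pose v := w \o cover_incl B.
have spjE z : spj z = 1 *: v z + j z.
  by rewrite /spj /v /= scale1r sp jE addrC.
(* [s p j = j + w], where [w] factors through [R^(B)], so [s p j] and [j]
   induce the same map. *)
have v0 := @pnull_through_free R X i _ _ _ (cover_incl B) w v phi2 (fun=> erefl).
have := pnullD (fmap_additive phi2 spjE) (pnullD v0 phi2E).
apply: pnull_ext => x /=; rewrite scale1r.
set a := phi2 _; set b := phi2 _; set c := phi2 _; set d := phi2 _.
have -> : d = a.
  rewrite /a /d; congr (phi2 _); apply/esym.
  apply: (@fmap_comp R i.+1 _ _ _ (Omega_map g) s spj) => z.
  by rewrite /spj /= pj.
by rewrite [b + (c - _)]addrA addrA subrK.
Qed.

(** Both sides are convertible; stating it for an arbitrary [f] keeps unification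
    away from the syzygies of a concrete kernel. *)
Lemma pnull_shift i A B (f : {linear A -> B}) (phi : {linear fsyz i.+2 B -> X}) :
  pnull (fun x => phi (fmap i.+2 f x)) ->
  @pnull R X i (Omega A)
    (fun x => (phi : {linear fsyz i.+1 (Omega B) -> X}) (fmap i.+1 (Omega_map f) x)).
Proof. by []. Qed.

Lemma pnull_exact i : middle_exact i.
Proof.
elim: i => [|i IH]; first exact: middle_exact0.
move=> B C g phi g_onto phi0.
have [phi' phi'E] := @middle_exact_Omega i IH B C g phi g_onto (pnull_shift phi0).
exists phi'.
exact phi'E.
Qed.

(** The first sequence: [r] is the cover of [B] restricted to [rsyz g], and its
    kernel is [Omega B]. *)
Lemma kernel_of_cover B C (g : {linear B -> C})
    (j : {linear Omega B -> rsyz g}) :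
  (forall z, rsyz_incl g (j z) = cover_incl B z) ->
  exists (r : {linear rsyz g -> kmod g}) (e : {linear kmod r -> Omega B}),
    [/\ onto r, forall z, ker_incl g (r z) = free_cover B (rsyz_incl g z) &
        forall z, j (e z) = ker_incl r z].
Proof.
move=> jE.
have [|r rE] := @ker_lift R _ _ _ g (free_cover B \o rsyz_incl g).
  by move=> x; exact: rsyz_incl0.
have [|e eE] := @Omega_lift R _ B (rsyz_incl g \o ker_incl r).
  by move=> z; rewrite -[LHS]rE /= ker_incl0 linear0.
exists r, e; split => //.
  move=> x; have [|l lE] := @rsyz_lift R B C g _ (free_map (ker_incl g)).
    by move=> y; rewrite free_cover_map; exact: ker_incl0.
  exists (l << x >>); apply: ker_incl_inj; rewrite rE /= lE free_cover_map.
  by rewrite free_coverU.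
by move=> z; apply: rsyz_incl_inj; rewrite jE eE.
Qed.

(** In degree [1]: if [phi] extends to [psi] over [R^(B)], then [psi] and [phi]
    agree on [rsyz g], because their difference factors through [ker g], which
    has no nonzero map to [X]. *)
Lemma pnull_inj1 B C (g : {linear B -> C}) (phi : {linear fsyz 1 C -> X}) :
  onto g -> all_null X 0 (kmod g) ->
  @pnull R X 0 B (fun x => phi (fmap 1 g x)) -> @pnull R X 0 C phi.
Proof.
move=> g_onto A0 [psi psiE]; pose phi1 : {linear Omega C -> X} := phi.
have [j [p [s [w [s0 [jE pj ps sp sE]]]]]] := rsyz_Omega g_onto.
have [r [e [r_onto rE je]]] := kernel_of_cover jE.
pose d : {linear rsyz g -> X} := (psi \o rsyz_incl g) \- (phi1 \o p).
have [z rz0|chi chiE] := factor_surj (c := d) r_onto.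
  have [k <-] := ker_incl_onto rz0; rewrite /d /= -je jE pj.
  by apply/eqP; rewrite subr_eq0; apply/eqP/esym/psiE.
exists (psi \o s0) => z; rewrite /= -sE -{1}[z]ps.
apply/eqP; rewrite eq_sym -subr_eq0; apply/eqP.
by rewrite -[LHS]/(d (s z)) -chiE A0.
Qed.

(** A class on [Omega C] that dies on [Omega B] gives one on [rsyz g] that comes
    from [Ext^(i+1)(ker g) = 0], by exactness for
    [0 -> Omega B -> rsyz g -> ker g -> 0]. *)
Lemma pnull_inj_Omega i B C (g : {linear B -> C})
    (phi : {linear fsyz i.+1 (Omega C) -> X}) :
  onto g -> all_null X i.+1 (kmod g) ->
  pnull (fun x => phi (fmap i.+1 (Omega_map g) x)) -> pnull phi.
Proof.
move=> g_onto A0 phi0.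
have [j [p [s [w [s0 [jE pj ps sp sE]]]]]] := rsyz_Omega g_onto.
have [r [e [r_onto rE je]]] := kernel_of_cover jE.
have dK : pnull (fun x => phi (fmap i.+1 p (fmap i.+1 (ker_incl r) x))).
  apply: (pnull_ext _ (pnull_pull e phi0)) => x; congr (phi _).
  pose u := p \o ker_incl r.
  rewrite -(@fmap_comp R i.+1 _ _ _ (ker_incl r) p u) //.
  apply/esym; apply: (@fmap_comp R i.+1 _ _ _ e (Omega_map g) u) => z.
  by rewrite /u /= -je pj.
have [chi chiE] := @pnull_exact i _ _ r (phi \o fmap i.+1 p) r_onto dK.
apply: (pnull_split ps).
have := pnullB (@pnull_pull R X i _ _ r _ (A0 chi)) chiE.
by apply: pnull_ext => x /=; rewrite opprB addrC subrK.
Qed.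

Lemma pnull_inj i B C (g : {linear B -> C}) (phi : {linear fsyz i.+2 C -> X}) :
  onto g -> all_null X i.+1 (kmod g) ->
  pnull (fun x => phi (fmap i.+2 g x)) -> pnull phi.
Proof.
move=> g_onto A0 phi0; exact: (@pnull_inj_Omega i B C g phi g_onto A0 (pnull_shift phi0)).
Qed.

End ExactSequence.

(** * Comparison with Ext *)

Section ExtClasses.
Variable R : comNzRingType.
Implicit Types N X : lmodType R.

(** The two modules are the same up to the order of the recursion, so every step
    is the identity. *)
Fixpoint Omega_fsyz i N {struct i} : {linear Omega (fsyz i N) -> fsyz i.+1 N} :=
  match i return {linear Omega (fsyz i N) -> fsyz i.+1 N} with
  | 0 => idfun
  | j.+1 => Omega_fsyz j (Omega N)
  end.

Fixpoint fsyz_Omega i N {struct i} : {linear fsyz i.+1 N -> Omega (fsyz i N)} :=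
  match i return {linear fsyz i.+1 N -> Omega (fsyz i N)} with
  | 0 => idfun
  | j.+1 => fsyz_Omega j (Omega N)
  end.

Lemma Omega_fsyzK i N : cancel (Omega_fsyz i N) (fsyz_Omega i N).
Proof. by elim: i N => [//|i IH] N; exact: (IH (Omega N)). Qed.

Lemma fsyz_OmegaK i N : cancel (fsyz_Omega i N) (Omega_fsyz i N).
Proof. by elim: i N => [//|i IH] N; exact: (IH (Omega N)). Qed.

Lemma Omega_fsyz_natural i N N' (f : {linear N -> N'}) x :
  Omega_fsyz i N' (Omega_map (fmap i f) x) = fmap i.+1 f (Omega_fsyz i N x).
Proof. by elim: i N N' f x => [//|i IH] N N' f x; exact: (IH _ _ (Omega_map f)). Qed.

Lemma pnull_Omega_fsyz X i N (phi : fsyz i.+1 N -> X) :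
  pnull phi <-> exists psi : {linear {malg R[fsyz i N]} -> X},
    forall y, phi (Omega_fsyz i N y) = psi (cover_incl (fsyz i N) y).
Proof. by elim: i N phi => [//|i IH] N phi; exact: (IH (Omega N)). Qed.
Arguments Omega_fsyz : simpl never.
Arguments fsyz_Omega : simpl never.

(** The identification of the two constructions of iterated syzygies. *)
Fixpoint syz_fsyz i N {struct i} : {linear syzygy N i -> fsyz i N} :=
  match i return {linear syzygy N i -> fsyz i N} with
  | 0 => idfun
  | j.+1 => Omega_fsyz j N \o
    (Omega_map (syz_fsyz j N) : {linear Omega (syzygy N j) -> Omega (fsyz j N)})
  end.

Fixpoint fsyz_syz i N {struct i} : {linear fsyz i N -> syzygy N i} :=
  match i return {linear fsyz i N -> syzygy N i} with
  | 0 => idfun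
  | j.+1 => (Omega_map (fsyz_syz j N) : {linear Omega (fsyz j N) -> Omega (syzygy N j)})
    \o fsyz_Omega j N
  end.

Lemma syz_fsyzS i N x : syz_fsyz i.+1 N x = Omega_fsyz i N (Omega_map (syz_fsyz i N) x).
Proof. by []. Qed.

Lemma syz_fsyzK i N : cancel (syz_fsyz i N) (fsyz_syz i N).
Proof.
elim: i N => [//|i IH] N x /=; rewrite Omega_fsyzK.
rewrite -(@Omega_map_comp R _ _ _ (syz_fsyz i N) (fsyz_syz i N) idfun) => [|y]; last by rewrite IH.
by rewrite Omega_map_id.
Qed.

Lemma fsyz_syzK i N : cancel (fsyz_syz i N) (syz_fsyz i N).
Proof.
elim: i N => [//|i IH] N x /=.
rewrite -(@Omega_map_comp R _ _ _ (fsyz_syz i N) (syz_fsyz i N) idfun) => [|y]; last by rewrite IH.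
by rewrite Omega_map_id // fsyz_OmegaK.
Qed.

Lemma syz_fsyz_natural i N N' (f : {linear N -> N'}) x :
  syz_fsyz i N' (syzygy_map f i x) = fmap i f (syz_fsyz i N x).
Proof.
elim: i x => [//|i IH] x /=.
rewrite -[fmap i.+1 f]/(fmap i (Omega_map f)) -Omega_fsyz_natural; congr (Omega_fsyz i N' _).
pose u := fmap i f \o syz_fsyz i N.
rewrite -(@Omega_map_comp R _ _ _ (syz_fsyz i N) (fmap i f) u) //.
by apply/esym; apply: (Omega_map_comp (f := syzygy_map f i) (g := syz_fsyz i N')) => y.
Qed.
Arguments syz_fsyz : simpl never.
Arguments fsyz_syz : simpl never.

(** A cocycle on the [i]-th term of the resolution vanishes on boundaries, so it
    is a linear map [phi] on the [i]-th syzygy composed with the cover of this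
    syzygy. *)
Definition ext_rep i N X (h : Ext i N X) (phi : {linear fsyz i N -> X}) : Prop :=
  exists z : ext_cocycle N X i, quotmod_proj _ z = h /\
    forall x : res_term N i,
      (val z : homMod _ _) x = phi (syz_fsyz i N (free_cover (syzygy N i) x)).

Lemma cover_res_diff i N x : free_cover (syzygy N i) (res_diff N i x) = 0.
Proof. exact/eqP/(valP (free_cover (syzygy N i.+1) x : ker _)). Qed.

Lemma ext_cocycleP i N X (c : homMod (res_term N i) X) :
  (exists z : ext_cocycle N X i, val z = c) <->
  forall x, c (res_diff N i x) = 0.
Proof.
split=> [[z <-] x|c0].
  have /eqP /(congr1 (fun h : homMod _ _ => h x)) := valP z; exact.
have cP : c \in ker_pred (ext_diff N X i).
  have dc0 := @homP R (res_term N i.+1) X (ext_diff N X i c) 0 c0.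
  by rewrite inE.
by exists (Ker cP).
Qed.

Lemma ext_rep_class i N X (phi : {linear fsyz i N -> X}) :
  exists h, ext_rep h phi.
Proof.
pose c : homMod (res_term N i) X :=
  (phi \o (syz_fsyz i N \o free_cover (syzygy N i)) : {linear res_term N i -> X}).
have [_ [|z zE]] := ext_cocycleP c.
  move=> x; rewrite -[LHS]/(phi (syz_fsyz i N (free_cover (syzygy N i) _))).
  by rewrite cover_res_diff !linear0.
by exists (quotmod_proj _ z), z; split=> // x; rewrite zE.
Qed.

Lemma res_diff_onto i N (x : res_term N i) :
  free_cover (syzygy N i) x = 0 -> exists y, res_diff N i y = x.
Proof.
move=> x0; case: i x x0 => [|i] x x0; first exact/(res_exact0 x).
by apply/(res_exact x); rewrite /res_diff /= x0.
Qed.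

Lemma ext_rep_exists i N X (h : Ext i N X) : exists phi, ext_rep h phi.
Proof.
pose z := repr h; have zh : quotmod_proj _ z = h by exact: quotmod_reprK.
pose c : {linear res_term N i -> X} := (val z : homMod _ _).
have [x x0|c' c'E] := factor_surj (c := c) (@free_cover_surj R (syzygy N i)).
  have [c0 _] := ext_cocycleP (val z); have {}c0 := c0 (ex_intro _ z erefl).
  have [y <-] := res_diff_onto x0; exact: c0.
exists (c' \o fsyz_syz i N), z; split=> // x.
by rewrite /= syz_fsyzK c'E.
Qed.

Lemma ext_coboundary_submod N X i (z : ext_cocycle N X i) :
  span (@ext_coboundary R N X i) z <-> ext_coboundary z.
Proof.
split=> [|zB]; last exact: sub_gen_smallest.
apply; split=> //; case: i z => [|i] z.
  by split=> [|r x y]; rewrite !inE //= => -> ->; rewrite scaler0 addr0.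
split=> [|r x y]; rewrite !inE; first by exists 0; rewrite linear0.
move=> [c xE] [d yE]; exists (r *: c + d).
by rewrite (linearP (ext_diff N X i)) -xE -yE.
Qed.

Lemma ext_diffE N X i (c : homMod (res_term N i) X) x :
  (ext_diff N X i c : homMod _ _) x =
  c (cover_incl (syzygy N i) (free_cover (syzygy N i.+1) x)).
Proof. by []. Qed.

Lemma ext_rep_null i N X (h : Ext i N X) (phi : {linear fsyz i N -> X}) :
  ext_rep h phi -> (h = 0 <-> null phi).
Proof.
move=> [z [<- zE]].
have -> : (quotmod_proj _ z = 0 :> Ext i N X) <-> ext_coboundary z.
  rewrite -ext_coboundary_submod -{2}[z]subr0 -quotmod_projP.
  by rewrite (linear0 (quotmod_proj _)).
case: i h phi z zE => [|i] _ phi z zE.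
  split=> [z0 x|phi0].
    have [g <-] := free_cover_surj x; rewrite -[LHS]zE z0; exact.
  apply: val_inj; apply: (@homP R (res_term N 0) X) => x.
  by rewrite zE; exact: phi0.
rewrite /null pnull_Omega_fsyz; split=> [[c zc]|[psi psiE]].
  exists (hom_fun c \o free_map (fsyz_syz i N)) => y.
  have [x xE] := @free_cover_surj R (syzygy N i.+1) (Omega_map (fsyz_syz i N) y).
  have := zE x; rewrite xE syz_fsyzS -(@Omega_map_comp R _ _ _ (fsyz_syz i N) (syz_fsyz i N) idfun).
    by rewrite Omega_map_id // => <-; rewrite zc [LHS]ext_diffE xE.
  by move=> t; rewrite fsyz_syzK.
exists (psi \o free_map (syz_fsyz i N) : {linear res_term N i -> X}).
apply: (@homP R (res_term N i.+1) X) => x.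
by rewrite zE syz_fsyzS psiE ext_diffE.
Qed.

Lemma ext_rep_map i N N' X (f : {linear N -> N'}) (h : Ext i N' X)
    (phi : {linear fsyz i N' -> X}) (psi : {linear fsyz i N -> X}) :
  (forall x, psi x = phi (fmap i f x)) ->
  ext_rep h phi -> ext_rep (Ext_map i X f h) psi.
Proof.
move=> psiE [z [<- zE]]; exists (ext_cocycle_map X f i z); split.
  exact/esym/(quotmod_map_proj (@ext_coboundary_subproof R N N' X f i)).
move=> x; rewrite psiE -syz_fsyz_natural -free_cover_map -zE.
by [].
Qed.

Lemma ext_rep_lin i N X r (h k : Ext i N X)
    (phi psi chi : {linear fsyz i N -> X}) :
  (forall x, chi x = r *: phi x + psi x) ->
  ext_rep h phi -> ext_rep k psi -> ext_rep (r *: h + k) chi.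
Proof.
move=> chiE [y [<- yE]] [z [<- zE]]; exists (r *: y + z); split.
  by rewrite (linearP (quotmod_proj _)).
by move=> x; rewrite chiE -yE -zE.
Qed.

End ExtClasses.

(** * Functoriality and exactness of Ext *)

Section ExtProperties.
Variables (R : comNzRingType) (X : lmodType R).
Implicit Types A B C N : lmodType R.

Definition ext_vanish i N := forall u : Ext i N X, u = 0.

Lemma ext_vanishP i N : ext_vanish i N <-> all_null X i N.
Proof.
split=> [van phi|van u].
  by have [u urep] := ext_rep_class phi; apply/(ext_rep_null urep)/van.
by have [phi urep] := ext_rep_exists u; apply/(ext_rep_null urep)/van.
Qed.

Lemma pnull0 i N : @pnull R X i N (fun=> 0).
Proof.
elim: i N => [|i IH] N; last exact: (IH (Omega N)).
by exists \0.
Qed.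

Lemma null0 i N : @null R X i N (fun=> 0).
Proof. by case: i => [//|i]; exact: pnull0. Qed.

Lemma ext_rep_eq i N (h k : Ext i N X) (phi psi : {linear fsyz i N -> X}) :
  ext_rep h phi -> ext_rep k psi ->
  (h = k <-> null (fun x => phi x - psi x)).
Proof.
move=> hrep krep; have [chi chiE] := linear_comb (-1) psi phi.
have -> : (h = k) <-> -1 *: k + h = 0.
  by rewrite scaleN1r addrC; split=> [->|/subr0_eq //]; rewrite subrr.
rewrite (ext_rep_null (ext_rep_lin chiE krep hrep)).
suff -> : (fun x => phi x - psi x) = chi by [].
by apply: funext => x; rewrite chiE scaleN1r addrC.
Qed.

Lemma ext_rep_comp i A B (f : {linear A -> B}) u (phi : {linear fsyz i B -> X}) :
  ext_rep u phi -> ext_rep (Ext_map i X f u) (phi \o fmap i f).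
Proof. exact: ext_rep_map. Qed.

Lemma Ext_map_comp i A B C (f : {linear A -> B}) (g : {linear B -> C})
    (h : {linear A -> C}) (u : Ext i C X) :
  (forall x, h x = g (f x)) ->
  Ext_map i X h u = Ext_map i X f (Ext_map i X g u).
Proof.
move=> hE; have [phi urep] := ext_rep_exists u.
have rep1 := ext_rep_comp h urep.
have rep2 := ext_rep_comp f (ext_rep_comp g urep).
apply/(ext_rep_eq rep1 rep2).
suff -> : (fun x => (phi \o fmap i h) x -
  ((phi \o fmap i g) \o fmap i f) x) = fun=> 0 by exact: null0.
by apply: funext => x; rewrite /= (@fmap_comp R i _ _ _ f g h hE) subrr.
Qed.

(** [r *: -] is [r] times the identity plus zero, so this is the linearity of
    [Ext] in the map. *)
Lemma Ext_map_scale i N r (f : {linear N -> N}) (u : Ext i N X) :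
  (forall x, f x = r *: x) -> Ext_map i X f u = r *: u.
Proof.
move=> fE; have [phi urep] := ext_rep_exists u.
have rep1 := ext_rep_comp f urep.
have [u0 u0rep] := @ext_rep_class R i N X \0.
have u00 : u0 = 0 by apply/(ext_rep_null u0rep)/null0.
have [psi psiE] := linear_comb r phi \0.
have rep2 := ext_rep_lin psiE urep u0rep.
rewrite u00 addr0 in rep2; apply/(ext_rep_eq rep1 rep2).
clear rep1 rep2 u0rep urep u00 u0 u; case: i phi psi psiE => [|i] phi psi psiE.
  by move=> x; rewrite psiE /= fE linearZ addr0 subrr.
have z0 := @pnull_through_free R X i N N void \0 \0 \0 phi (fun=> erefl).
have fE' x : f x = r *: (idfun : {linear N -> N}) x + (\0 : {linear N -> N}) x.
  by rewrite fE addr0.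
have := pnullD (fmap_additive phi fE') z0.
apply: pnull_ext => x /=; rewrite psiE addr0 opprD addrA subrK.
by congr (_ - _ *: phi _); apply: fmap_id.
Qed.

Lemma Ext_map_exact i B C (g : {linear B -> C}) (u : Ext i B X) :
  onto g -> Ext_map i X (ker_incl g) u = 0 -> exists v, Ext_map i X g v = u.
Proof.
move=> g_onto; have [phi urep] := ext_rep_exists u.
move=> /(ext_rep_null (ext_rep_comp (ker_incl g) urep)) phi0.
suff [psi psiE] : exists psi : {linear fsyz i C -> X},
    null (fun x => psi (fmap i g x) - phi x).
  have [v vrep] := ext_rep_class psi; exists v.
  exact/(ext_rep_eq (ext_rep_comp g vrep) urep).
case: i u phi phi0 {urep} => [|i] u phi phi0; last exact: pnull_exact.
have [x gx0|psi psiE] := @factor_surj R _ _ _ g phi g_onto.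
  by have [k <-] := ker_incl_onto gx0; exact: phi0.
by exists psi => x; rewrite -[fmap 0 g x]/(g x) psiE subrr.
Qed.

(** The kernel of [Ext^i(C) -> Ext^i(B)] is a quotient of [Ext^(i-1)(ker g)];
    in degree [0] the map is always injective. *)
Lemma Ext_map_inj i B C (g : {linear B -> C}) :
  onto g -> (forall j, i = j.+1 -> ext_vanish j (kmod g)) ->
  forall u, Ext_map i X g u = 0 -> u = 0.
Proof.
move=> g_onto van u; have [phi urep] := ext_rep_exists u.
move=> /(ext_rep_null (ext_rep_comp g urep)) phi0.
apply/(ext_rep_null urep).
case: i u phi urep phi0 van => [|[|i]] u phi urep phi0 van.
- by move=> y; have [x <-] := g_onto y; exact: phi0.
- by apply: (pnull_inj1 g_onto _ phi0); apply/ext_vanishP/van.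
- by apply: (pnull_inj g_onto _ phi0); apply/ext_vanishP/van.
Qed.

End ExtProperties.

(** * Submodules over a Noetherian ring *)

Section Submodules.
Variables (R : comNzRingType).
Implicit Types V W N : lmodType R.

Lemma is_submodP V (S : set V) : is_submod S <->
  S 0 /\ forall c x y, S x -> S y -> S (c *: x + y).
Proof.
split=> [[S0 Slin]|[S0 Slin]].
  split=> [|c x y Sx Sy]; first by move: S0; rewrite !inE.
  by have := Slin c x y; rewrite !inE; apply.
by split=> [|c x y]; rewrite !inE //; exact: Slin.
Qed.

Lemma span_sub V (A S : set V) : is_submod S -> A `<=` S -> span A `<=` S.
Proof. by move=> Ssub AS x; apply. Qed.

Lemma span_linear V W (f : {linear V -> W}) (A : set V) (B : set W) :
  (forall x, A x -> span B (f x)) -> forall x, span A x -> span B (f x).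
Proof.
move=> fAB; apply: span_sub => //; apply/is_submodP.
split=> [|c x y]; first by rewrite linear0; exact: span0.
by rewrite linearP; exact: spanP.
Qed.

Lemma span_cons V x (s : seq V) y :
  span [set` x :: s] y <-> exists r, exists2 z, span [set` s] z & y = r *: x + z.
Proof.
have xs : span [set` x :: s] x.
  by apply: sub_gen_smallest; rewrite /= inE eqxx.
split; last first.
  move=> [r [z zs ->]]; apply: spanP => //; apply: span_mono zs => t /= ts.
  by rewrite inE ts orbT.
move: y; apply: span_sub => [|t /=].
  apply/is_submodP; split=> [|c y z [r [y' y's ->]] [r' [z' z's ->]]].
    by exists 0, 0; [exact: span0|rewrite scale0r addr0].
  exists (c * r + r'), (c *: y' + z'); first exact: spanP.
  by rewrite scalerDr scalerDl !scalerA addrACA.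
rewrite inE => /orP[/eqP->|ts].
  by exists 1, 0; [exact: span0|rewrite scale1r addr0].
by exists 0, t; [exact: sub_gen_smallest|rewrite scale0r add0r].
Qed.

Lemma span_nil V (x : V) : span [set` [::]] x -> x = 0.
Proof.
move: x; apply: span_sub => //; apply/is_submodP.
by split=> // c x y -> ->; rewrite scaler0 addr0.
Qed.

Definition fg N := exists s : seq N, forall x, span [set` s] x.

Lemma fg_onto N N' (g : {linear N -> N'}) : onto g -> fg N -> fg N'.
Proof.
move=> g_onto [s sN]; exists (map g s) => y; have [x <-] := g_onto y.
apply: span_linear (sN x) => t /= ts; apply: sub_gen_smallest => /=.
exact: map_f.
Qed.

Hypothesis R_noeth : noetherian R.

(** Hilbert's argument: for [N] generated by [x :: s], the coefficients of [x] in
    the elements of [S] form an ideal [I]; lifts of generators of [I] together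
    with generators of [S] within the span of [s] generate [S]. *)
Lemma noeth_submod N (s : seq N) (S : set N) : is_submod S ->
  S `<=` span [set` s] -> fin_gen S.
Proof.
elim: s S => [|x s IH] S Ssub Ss.
  exists [::]; apply/seteqP; split=> y; last exact: span_sub.
  by move=> /Ss/span_nil->; exact: span0.
have [S0 Slin] := (is_submodP S).1 Ssub.
pose I : set R := [set r | exists2 y, span [set` s] y & S (r *: x + y)].
have /R_noeth[rs rsE] : is_ideal I.
  apply/is_submodP; split=> [|c r r' [y ys Sy] [y' y's Sy']].
    by exists 0; [exact: span0|rewrite scale0r addr0].
  exists (c *: y + y'); first exact: spanP.
  have -> : (c *: r + r' : R^o) *: x + (c *: y + y') =
      c *: (r *: x + y) + (r' *: x + y').
    by rewrite [(_ + _ : R^o) *: x]scalerDl scalerDr -scalerA addrACA.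
  exact: Slin.
have [t tE] : fin_gen (S `&` span [set` s]).
  apply: IH => [|y [] //]; apply/is_submodP.
  split=> [|c y z [Sy ys] [Sz zs]]; first by split=> //; exact: span0.
  by split; [exact: Slin|exact: spanP].
have [zs [zsS zsP]] : exists zs : seq N, (forall z, z \in zs -> S z) /\
    forall r, span ([set` rs] : set R^o) r ->
      exists2 z, span [set` zs] z & span [set` s] (z - r *: x).
  have : forall r, r \in rs -> I r.
    by move=> r rrs; rewrite rsE; apply: sub_gen_smallest.
  elim: rs {rsE} => [|r rs IHrs] rsI.
    exists [::]; split=> // r /span_nil ->.
    by exists 0; [exact: span0|rewrite scale0r subrr; exact: span0].
  have [|zs [zsS zsP]] := IHrs; first by move=> r' r'rs; apply: rsI; rewrite inE r'rs orbT.
  have [|y ys Sy] := rsI r; first by rewrite inE eqxx.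
  exists ((r *: x + y) :: zs); split=> [z|r'].
    by rewrite inE => /orP[/eqP->//|]; exact: zsS.
  move=> /span_cons[c [r'' /zsP[z zzs zr''] ->]].
  exists (c *: (r *: x + y) + z); first by apply/span_cons; exists c, z.
  have -> : c *: (r *: x + y) + z - (c *: r + r'' : R^o) *: x =
      c *: y + (z - r'' *: x).
    rewrite [(_ + _ : R^o) *: x]scalerDl scalerDr -scalerA opprD.
    by rewrite addrACA; congr (_ + _); rewrite addrAC subrr add0r.
  exact: spanP.
have zst : [set` zs ++ t] `<=` S.
  move=> z /=; rewrite mem_cat => /orP[/zsS//|zt].
  suff [] : (S `&` span [set` s]) z by [].
  by rewrite tE; apply: sub_gen_smallest.
exists (zs ++ t); apply/seteqP; split=> y; last exact: span_sub.
move=> Sy; have /span_cons[r [y' y's yE]] := Ss y Sy.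
have [|z zzs zr] := zsP r.
  by rewrite -rsE; exists y' => //; rewrite -yE.
have zS : S z by apply: span_sub zzs => // w; exact: zsS.
have yz : span [set` t] (y - z).
  rewrite -tE; split; first by rewrite addrC -scaleN1r; exact: Slin.
  have -> : y - z = -1 *: (z - r *: x) + y'.
    by rewrite yE scaleN1r opprB addrAC.
  exact: spanP.
rewrite -[y](subrK z) addrC -[X in X + _]scale1r; apply: spanP.
  by apply: span_mono zzs => w /= wzs; rewrite mem_cat wzs.
by apply: span_mono yz => w /= wt; rewrite mem_cat wt orbT.
Qed.

Lemma fg_kmod N N' (g : {linear N -> N'}) : fg N -> fg (kmod g).
Proof.
move=> [s sN].
have [|y _|t tE] := @noeth_submod N s [set x | g x = 0]; last first.
- have [w wt] : exists w : seq (kmod g), map (ker_incl g) w = t.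
    have : forall x, x \in t -> g x = 0.
      move=> x xt; suff : [set x | g x = 0] x by [].
      by rewrite tE; exact: sub_gen_smallest.
    elim: t {tE} => [|x t IH] t0; first by exists [::].
    have [|k kx] := @ker_incl_onto R _ _ g x; first by rewrite t0 // inE eqxx.
    have [|w wt] := IH; first by move=> y yt; rewrite t0 // inE yt orbT.
    by exists (k :: w); rewrite /= kx wt.
  exists w => k; suff [k' k'w /ker_incl_inj<-//] :
      exists2 k', span [set` w] k' & ker_incl g k' = ker_incl g k.
  have : span [set` t] (ker_incl g k) by rewrite -tE /= ker_incl0.
  move: (ker_incl g k); apply: span_sub => [|x /=].
    apply/is_submodP; split=> [|c x y [x' x'w <-] [y' y'w <-]].
      by exists 0; [exact: span0|rewrite linear0].
    by exists (c *: x' + y'); [exact: spanP|rewrite linearP].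
  rewrite -wt => /mapP[k' k'w ->]; exists k' => //.
  exact: sub_gen_smallest.
- exact: sN.
- apply/is_submodP; split=> [|c x y /= x0 y0]; first by rewrite /= linear0.
  by rewrite linearP x0 y0 scaler0 addr0.
Qed.

(** Noetherian induction: a finitely generated union of a chain belongs to the
    chain, so by Zorn a counterexample could be taken maximal. *)
Lemma noeth_ideal_ind (P : set R -> Prop) :
  (forall J, is_ideal J ->
    (forall J', is_ideal J' -> J `<` J' -> P J') -> P J) ->
  forall J, is_ideal J -> P J.
Proof.
move=> Pstep J Jideal; apply: contrapT => nPJ.
pose Q : set (set R) := [set J | (is_ideal J /\ ~ P J) \/ J = set0].
have [|J0 [J0Q J0max]] := @Zorn_bigcup R Q.
  move=> F FQ Ftot; set U := \bigcup_(X in F) X.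
  have [[J1 FJ1 [J1ideal nPJ1]]|noF] :=
      pselect (exists2 J1, F J1 & is_ideal J1 /\ ~ P J1); last first.
    right; apply/seteqP; split=> // x [Y FY Yx].
    by case: (FQ Y FY) Yx => [?|->//]; case: noF; exists Y.
  have FU : forall s : seq R, (forall x, x \in s -> U x) ->
      exists2 Y, F Y /\ (is_ideal Y /\ ~ P Y) & forall x, x \in s -> Y x.
    elim=> [_|x s IH xsU]; first by exists J1.
    have [|Y [FY YP] sY] := IH; first by move=> y ys; apply: xsU; rewrite inE ys orbT.
    have [|Z FZ Zx] := xsU x; first by rewrite inE eqxx.
    have [YZ|ZY] := Ftot Y Z FY FZ.
      exists Z; last by move=> y; rewrite inE => /orP[/eqP->//|/sY/YZ].
      by split=> //; case: (FQ Z FZ) => // Z0; rewrite Z0 in Zx.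
    by exists Y => // y; rewrite inE => /orP[/eqP->|/sY//]; exact: ZY.
  have Uideal : is_ideal U.
    apply/is_submodP; split.
      by exists J1 => //; have [] := (@is_submodP R^o J1).1 J1ideal.
    move=> c x y Ux Uy; have [|Y [FY [Yideal _]] xyY] := FU [:: x; y].
      by move=> z; rewrite !inE => /orP[]/eqP->.
    have [_ Ylin] := (@is_submodP R^o Y).1 Yideal.
    by exists Y => //; apply: Ylin; apply: xyY; rewrite !inE eqxx ?orbT.
  have [s sE] := R_noeth Uideal.
  have [|Y [FY YP] sY] := FU s.
    by move=> x xs; rewrite sE; exact: sub_gen_smallest.
  suff -> : U = Y by left.
  apply/seteqP; split=> [|x Yx]; last by exists Y.
  by rewrite sE; apply: (@span_sub R^o); [case: YP|exact: sY].
have J0neq : J0 <> set0.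
  move=> J00; apply: (J0max J); last by left.
  have [J_0 _] := (@is_submodP R^o J).1 Jideal.
  by rewrite J00; split=> // /(_ 0 J_0).
case: J0Q => // -[J0ideal nPJ0]; apply: nPJ0; apply: Pstep => // J' J'ideal J0J'.
by apply: contrapT => nPJ'; apply: (J0max J' J0J'); left.
Qed.

End Submodules.

(** * Vanishing and injectivity on a support *)

Section Support.
Variables (R : comNzRingType).
Implicit Types B C N T V : lmodType R.

Definition ann N : set R := [set r | forall x : N, r *: x = 0].

(** The support of [N] lies in that of [T], for [N] finitely generated. *)
Definition supported T N := fg N /\
  forall p, prime_ideal p -> ann N `<=` p -> ann T `<=` p.

Lemma supported_refl T : fg T -> supported T T.
Proof. by []. Qed.

Lemma supported_kmod T N N' (g : {linear N -> N'}) :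
  noetherian R -> supported T N -> supported T (kmod g).
Proof.
move=> R_noeth [Nfg Nsupp]; split; first exact: fg_kmod.
move=> p pprime annp; apply: Nsupp => // r rN; apply: annp => x.
by apply: ker_incl_inj; rewrite linearZ /= rN linear0.
Qed.

Lemma supported_onto T N N' (g : {linear N -> N'}) :
  onto g -> supported T N -> supported T N'.
Proof.
move=> g_onto [Nfg Nsupp]; split; first exact: fg_onto Nfg.
move=> p pprime annp; apply: Nsupp => // r rN; apply: annp => y.
by have [x <-] := g_onto y; rewrite -linearZ rN linear0.
Qed.

Lemma quotmod_proj_eq0 V (S : set V) x : quotmod_proj S x = 0 <-> span S x.
Proof. by rewrite -(linear0 (quotmod_proj S)) quotmod_projP subr0. Qed.

Lemma quotmod_proj_onto V (S : set V) : onto (quotmod_proj S).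
Proof. by move=> q; exists (repr q); exact: quotmod_reprK. Qed.

Lemma span1 V (x y : V) : span [set` [:: x]] y <-> exists r, y = r *: x.
Proof.
rewrite span_cons; split=> [[r [z /span_nil-> ->]]|[r ->]].
  by exists r; rewrite addr0.
by exists r, 0; [exact: span0|rewrite addr0].
Qed.

Lemma quotmod_proj1 V (x : V) : quotmod_proj [set` [:: x]] x = 0.
Proof. by apply/quotmod_proj_eq0/span1; exists 1; rewrite scale1r. Qed.

(** Finitely generated modules are built by successive extensions of cyclic
    modules. *)
Lemma fg_ind (P : lmodType R -> Prop) :
  (forall N, (forall x : N, x = 0) -> P N) ->
  (forall N (x : N), P (quotmod [set` [:: x]]) -> P N) ->
  forall N, fg N -> P N.
Proof.
move=> P0 Pquot N [s]; have [m] := ubnP (size s).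
elim: m N s => [//|m IH] N [|x s] /= sm sN.
  by apply: P0 => x; exact: (span_nil (sN x)).
apply: (Pquot N x); pose g : {linear N -> _} := quotmod_proj [set` [:: x]].
apply: (IH _ (map g s)); first by rewrite size_map.
move=> q; have [y <-] := @quotmod_proj_onto N [set` [:: x]] q.
have /span_cons[r [z zs ->]] := sN y.
rewrite (linearP g) [g x]quotmod_proj1 scaler0 add0r.
apply: span_linear zs => t ts.
by apply: sub_gen_smallest; exact: map_f.
Qed.

(** Kill the first generator [x] of [T].  If the quotient still has its annihilator
    in [p], use induction.  Otherwise some [c] outside [p] maps [T] into [R x];
    then the annihilator of [x] is in [p], and [T -> R x -> R / p], [t |-> c t],
    is nonzero at [x]. *)
Lemma nonzero_map T (p : set R) N (x0 : N) :
  fg T -> prime_ideal p -> ann T `<=` p -> (forall r, r *: x0 = 0 <-> p r) ->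
  exists f : {linear T -> N}, exists t, f t <> 0.
Proof.
move=> + [pideal p1 pmul] + x0p; move: T.
apply: fg_ind => [T T0 annp|T x IH annp].
  by case: p1; apply: annp => x; rewrite [x]T0 scaler0.
have [annp'|/existsNP[c /not_implyP[cann pc]]] :=
    pselect (ann (quotmod [set` [:: x]]) `<=` p).
  have [f [q fq]] := IH annp'.
  have [t tq] := @quotmod_proj_onto T [set` [:: x]] q.
  by exists (f \o quotmod_proj [set` [:: x]]), t; rewrite /= tq.
have px d : d *: x = 0 -> p d.
  move=> dx; have : p (d * c).
    apply: annp => t; have := cann (quotmod_proj _ t).
    rewrite -linearZ => /quotmod_proj_eq0/span1[r ct].
    by rewrite -scalerA ct scalerA mulrC -scalerA dx scaler0.
  by move=> /pmul[].
have /choice[r rE] : forall t : T, exists r, c *: t = r *: x.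
  move=> t; have := cann (quotmod_proj _ t).
  by rewrite -linearZ => /quotmod_proj_eq0/span1.
have x0E a b : a *: x = b *: x -> a *: x0 = b *: x0.
  move=> abx; apply/subr0_eq; rewrite -scalerBl; apply/x0p/px.
  by rewrite scalerBl abx subrr.
have [|f fE] := @linear_exists R T N (fun t => r t *: x0).
  move=> a y z /=; rewrite scalerA -scalerDl; apply: x0E.
  by rewrite -rE scalerDr scalerDl -scalerA -!rE !scalerA mulrC.
exists f, x; rewrite fE; have -> : r x *: x0 = c *: x0 by apply: x0E; rewrite rE.
by move/x0p.
Qed.

Section Vanishing.
Hypothesis R_noeth : noetherian R.
Variables (X T : lmodType R) (i : nat).
Hypothesis T_fg : fg T.
Hypothesis vanish_lt :
  forall N, supported T N -> forall j, (j < i)%N -> ext_vanish X j N.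

Lemma Ext_map_inj_supported B C (g : {linear B -> C}) :
  onto g -> supported T B -> forall u, Ext_map i X g u = 0 -> u = 0.
Proof.
move=> g_onto Bsupp; apply: Ext_map_inj => // j ij.
by apply: vanish_lt; [exact: supported_kmod|rewrite ij].
Qed.

Lemma Ext_map_scale0 N N' (f : {linear N -> N'}) (u : Ext i N' X) :
  (forall x, f x = 0) -> Ext_map i X f u = 0.
Proof.
move=> f0; have f0f x : f x = f ((\0 : {linear N -> N}) x) by rewrite f0 linear0.
rewrite (Ext_map_comp u f0f) (@Ext_map_scale _ _ _ _ 0) ?scale0r // => x.
by rewrite scale0r.
Qed.

(** A class that dies on [N] dies on the image of [f], onto which [N] surjects, so
    it comes from the cokernel of [f]. *)
Lemma Ext_map_exact_image N N' (f : {linear N -> N'}) (u : Ext i N' X) :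
  supported T N -> Ext_map i X f u = 0 ->
  exists v, Ext_map i X (quotmod_proj [set y | exists x, f x = y]) v = u.
Proof.
set S := [set y | _] => Nsupp fu0; pose g := quotmod_proj S.
have Ssub : is_submod S.
  apply/is_submodP; split=> [|c _ _ [x <-] [y <-]]; first by exists 0; rewrite linear0.
  by exists (c *: x + y); rewrite linearP.
have [|f' f'E] := @ker_lift R _ _ _ g f.
  move=> x; apply/quotmod_proj_eq0; apply: sub_gen_smallest; by exists x.
apply: Ext_map_exact; first exact: quotmod_proj_onto.
apply: (@Ext_map_inj_supported _ _ f') => //.
  move=> k; have : span S (ker_incl g k) by apply/quotmod_proj_eq0/ker_incl0.
  move=> /(span_sub Ssub (@subset_refl _ S))[x fx].
  by exists x; apply: ker_incl_inj; rewrite f'E.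
by rewrite -(Ext_map_comp (h := f)).
Qed.

(** On the zero module, multiplication by [1] is multiplication by [0]. *)
Lemma ext_vanish0 N : (forall x : N, x = 0) -> ext_vanish X i N.
Proof.
move=> N0 u; rewrite -[u]scale1r -(@Ext_map_scale _ _ _ _ _ idfun) => [|x].
  by rewrite Ext_map_scale0.
by rewrite scale1r.
Qed.

Lemma ext_vanish_extension B C (g : {linear B -> C}) : onto g ->
  ext_vanish X i (kmod g) -> ext_vanish X i C -> ext_vanish X i B.
Proof.
move=> g_onto kvan Cvan u.
have [v <-] := Ext_map_exact g_onto (kvan (Ext_map i X (ker_incl g) u)).
by rewrite (Cvan v) linear0.
Qed.

Definition cyclic N (x0 : N) := forall y, exists r, y = r *: x0.

Lemma cyclic_onto N N' (g : {linear N -> N'}) x0 :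
  onto g -> cyclic x0 -> cyclic (g x0).
Proof.
move=> g_onto x0N y; have [x <-] := g_onto y; have [r ->] := x0N x.
by exists r; rewrite linearZ.
Qed.

Lemma ann_ideal N (x0 : N) : is_ideal [set r | r *: x0 = 0].
Proof.
apply/is_submodP; split=> [|c r s /= r0 s0]; first exact: scale0r.
by rewrite [LHS]scalerDl -[_ *: x0]scalerA r0 s0 scaler0 addr0.
Qed.

Hypothesis T_vanish : ext_vanish X i T.

(** Noetherian induction on the annihilator [J] of [x0].  Any quotient of [N] in
    which some [r] outside [J] kills [x0] is covered by the induction ([step]).
    If [J] is prime, the cokernel of a nonzero map [T -> N] is such a quotient.
    If [r s] is in [J] but not [r] nor [s], then [N / r N] is such a quotient and
    [r N] is cyclic with [s] in its annihilator. *)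
Lemma ext_vanish_cyclic N (x0 : N) :
  cyclic x0 -> supported T N -> ext_vanish X i N.
Proof.
have [J JE] : exists J, J = [set r | r *: x0 = 0] by eexists.
have : is_ideal J by rewrite JE; exact: ann_ideal.
move=> Jid; move: J Jid N x0 JE; apply: (noeth_ideal_ind R_noeth) => J Jid IH.
move=> N x0 JE x0N Nsupp.
have xJ r : r *: x0 = 0 <-> J r by rewrite JE.
have step N' (g : {linear N -> N'}) r : onto g -> ~ J r -> r *: g x0 = 0 ->
    ext_vanish X i N'.
  move=> g_onto Jr gr0.
  apply: (IH [set r | r *: g x0 = 0] _ _ N' (g x0)) => //.
  - exact: ann_ideal.
  - split=> [s /xJ sx0|/(_ r gr0)//].
    by rewrite /= -linearZ sx0 linear0.
  - exact: cyclic_onto.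
  - exact: supported_onto Nsupp.
have [Jprime|Jnp] := pselect (prime_ideal J).
  have annT : ann T `<=` J.
    by have [_] := Nsupp; apply=> // r rN; apply/xJ.
  have [f [t ft]] := nonzero_map T_fg Jprime annT xJ.
  move=> u; have [v <-] := Ext_map_exact_image (supported_refl T_fg)
    (T_vanish (Ext_map i X f u)).
  have [r rE] := x0N (f t).
  rewrite (step _ (quotmod_proj _) r _ _ _ v) ?linear0 //.
  - exact: quotmod_proj_onto.
  - by move=> /xJ rx0; apply: ft; rewrite rE rx0.
  - rewrite -linearZ -rE; apply/quotmod_proj_eq0; apply: sub_gen_smallest.
    by exists t.
have [J1|J1] := pselect (J 1).
  apply: ext_vanish0 => x; have [r ->] := x0N x.
  by move/xJ: J1; rewrite scale1r => ->; rewrite scaler0.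
have [r [s [Jrs Jr Js]]] : exists r s, [/\ J (r * s), ~ J r & ~ J s].
  apply: contrapT => H; apply: Jnp; split=> // r s Jrs.
  by apply: contrapT => /not_orP[Jr Js]; apply: H; exists r, s.
pose g : {linear N -> _} := quotmod_proj [set` [:: r *: x0]].
have g_onto : onto g by exact: quotmod_proj_onto.
have grx0 : g (r *: x0) = 0 := quotmod_proj1 _.
(* The kernel of [g] is [r N], generated by [k0]. *)
have [k0 k0E] := ker_incl_onto grx0.
apply: (ext_vanish_extension g_onto); last first.
  by apply: (step _ g r) => //; rewrite -linearZ.
apply: (IH [set r | r *: k0 = 0] _ _ (kmod g) k0) => //.
- exact: ann_ideal.
- split=> [t /xJ tx0|/(_ s) H].
    by apply: ker_incl_inj; rewrite linearZ /= k0E scalerA mulrC -scalerA tx0 scaler0 linear0.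
  apply: Js; apply: H; apply: ker_incl_inj.
  by rewrite linearZ /= k0E scalerA mulrC linear0; apply/xJ.
- move=> k; have /quotmod_proj_eq0/span1[t tE] := ker_incl0 k.
  by exists t; apply: ker_incl_inj; rewrite linearZ /= k0E.
- exact: supported_kmod.
Qed.

Lemma ext_vanish_supported N : supported T N -> ext_vanish X i N.
Proof.
move=> Nsupp; have [Nfg _] := Nsupp; move: N Nfg Nsupp.
apply: fg_ind => [N N0 _|N x IH Nsupp]; first exact: ext_vanish0.
pose g : {linear N -> _} := quotmod_proj [set` [:: x]].
have g_onto : onto g by exact: quotmod_proj_onto.
have gx : g x = 0 := quotmod_proj1 x.
have [k0 k0E] := ker_incl_onto gx.
apply: (ext_vanish_extension g_onto); last exact/IH/(supported_onto g_onto).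
apply: (@ext_vanish_cyclic _ k0); last exact: supported_kmod.
move=> k; have /quotmod_proj_eq0/span1[t tE] := ker_incl0 k.
by exists t; apply: ker_incl_inj; rewrite linearZ /= k0E.
Qed.

(** One element [r] at a time: a class killed by [r] dies along multiplication by
    [r], so it comes from [N / r N], where it remains killed by the others since
    [Ext^i(N / r N) -> Ext^i(N)] is injective. *)
Lemma Ext_factor_killed N (u : Ext i N X) (s : seq R) :
  supported T N -> (forall r, r \in s -> r *: u = 0) ->
  exists (N' : lmodType R) (g : {linear N -> N'}) (v : Ext i N' X),
    Ext_map i X g v = u /\ forall r, r \in s -> forall y, g (r *: y) = 0.
Proof.
elim: s N u => [|r s IH] N u Nsupp su.
  exists N, idfun, u; split=> //.
  by rewrite (@Ext_map_scale _ _ _ _ 1) ?scale1r // => x; rewrite scale1r.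
have [|f fE] := @linear_exists R N N (fun x => r *: x).
  by move=> c x y; rewrite scalerDr !scalerA mulrC.
have fu0 : Ext_map i X f u = 0.
  by rewrite (Ext_map_scale u fE) su // inE eqxx.
have [v vu] := Ext_map_exact_image Nsupp fu0.
set S := [set y | exists x, f x = y] in v vu.
pose g : {linear N -> _} := quotmod_proj S.
have g_onto : onto g by exact: quotmod_proj_onto.
have [|t ts|N' [g' [w [wv g's]]]] := IH _ v.
- exact: (supported_onto g_onto).
- apply: (Ext_map_inj_supported g_onto Nsupp).
  by rewrite linearZ [Ext_map i X g v]vu -[LHS]/(t *: u) su // inE ts orbT.
exists N', (g' \o g), w; split.
  by rewrite (Ext_map_comp (f := g) (g := g')) // wv.
move=> t; rewrite inE => /orP[/eqP->|ts] y; last by rewrite /= linearZ g's.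
suff gry : g (r *: y) = 0 by rewrite /= gry linear0.
by apply/quotmod_proj_eq0; apply: sub_gen_smallest; exists y; rewrite fE.
Qed.

End Vanishing.
End Support.

(** * Elements of a direct limit *)

Section DirectLimits.
Variables (R : comNzRingType) (E : nat -> lmodType R).
Variable phi : forall k l : nat, (k <= l)%N -> {linear E k -> E l}.
Hypothesis phi_comp : forall k l m (kl : (k <= l)%N) (lm : (l <= m)%N)
  (km : (k <= m)%N) x, phi km x = phi lm (phi kl x).

Definition limcl k (x : E k) : dirlim phi :=
  quotmod_proj (dirlim_rel phi) (dirlim_gen E k x).

Lemma limclP k r (x y : E k) : limcl (r *: x + y) = r *: limcl x + limcl y.
Proof.
rewrite /limcl -(linearP (quotmod_proj (dirlim_rel phi))).
apply/quotmod_projP; apply: sub_gen_smallest; left; by exists k, r, x, y.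
Qed.

Lemma limcl0 k : limcl (0 : E k) = 0.
Proof.
by have := limclP (-1) (0 : E k) 0; rewrite scaler0 addr0 scaleN1r addNr.
Qed.

Lemma limclZ k r (x : E k) : limcl (r *: x) = r *: limcl x.
Proof. by rewrite -[r *: x]addr0 limclP limcl0 addr0. Qed.

Lemma limcl_trans k l (kl : (k <= l)%N) x : limcl (phi kl x) = limcl x.
Proof.
apply/esym/quotmod_projP; apply: sub_gen_smallest; right; by exists k, l, kl, x.
Qed.

(** The sum of two classes is represented at any common later stage. *)
Lemma limcl_exists (m : nat) (h : dirlim phi) :
  exists2 k, (m <= k)%N & exists x : E k, h = limcl x.
Proof.
suff [k [x hx]] : exists k (x : E k), h = limcl x.
  exists (maxn m k); first exact: leq_maxl.
  by exists (phi (leq_maxr m k) x); rewrite limcl_trans.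
rewrite -[h]quotmod_reprK [repr h]monalgE linear_sum /=.
elim/big_ind: _ => [|_ _ [k [x ->]] [l [y ->]]|[k x] _].
- by exists 0, 0; rewrite limcl0.
- exists (maxn k l), (phi (leq_maxl k l) x + phi (leq_maxr k l) y).
  by rewrite -[X in limcl (X + _)]scale1r limclP scale1r !limcl_trans.
- set c := (repr h)@__; exists k, (c *: x); rewrite limclZ /limcl -linearZ /=.
  congr (quotmod_proj _ _); apply/malgP => t.
  by rewrite mcoeffZ !mcoeffU mulrnAr mulr1.
Qed.

(** The value at stage [l] of an element of an earlier stage, set to [0] on the
    later stages so as to be defined on all generators of the direct limit. *)
Definition transport l (t : {k : nat & E k}) : E l :=
  match @idP (tag t <= l)%N with
  | ReflectT tl => phi tl (tagged t)
  | ReflectF _ => 0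
  end.

Lemma transportE k l (kl : (k <= l)%N) (x : E k) :
  transport l (Tagged (fun k => E k) x) = phi kl x.
Proof.
rewrite /transport; case: {-}_ / idP => [kl'|/(_ kl) //].
by rewrite (bool_irrelevance kl' kl).
Qed.

(** The combinations of generators whose transport is [0] at all late stages form
    a submodule that contains the relations of the direct limit. *)
Lemma limcl_eq0 k (x : E k) : limcl x = 0 ->
  exists l, exists kl : (k <= l)%N, phi kl x = 0.
Proof.
move=> /quotmod_proj_eq0.
pose S := [set g | exists l0, forall l, (l0 <= l)%N -> free_lift (transport l) g = 0].
have Ssub : is_submod S.
  apply/is_submodP; split=> [|c f g [l0 fl0] [l1 gl1]].
    by exists 0%N => l _; rewrite linear0.
  exists (maxn l0 l1) => l; rewrite geq_max => /andP[l0l l1l].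
  by rewrite linearP /= fl0 // gl1 // scaler0 addr0.
have gen_lift j l (jl : (j <= l)%N) (y : E j) :
    free_lift (transport l) (dirlim_gen E j y) = phi jl y.
  by rewrite [LHS]free_liftU transportE.
move=> /(span_sub Ssub)[].
  move=> _ [[j [r [y [z ->]]]]|[j [j' [jj' [y ->]]]]].
    exists j => l jl.
    by rewrite linearB linearD linearZ /= !(gen_lift _ _ jl) linearP subrr.
  exists j' => l j'l; have jl := leq_trans jj' j'l.
  by rewrite linearB /= (gen_lift _ _ jl) (gen_lift _ _ j'l) -phi_comp subrr.
move=> l0 l0P; exists (maxn l0 k), (leq_maxr l0 k).
by rewrite -gen_lift l0P // leq_maxl.
Qed.

End DirectLimits.

(** * The quotients by powers of an ideal *)

Local Opaque Ext_map.

Section PowerQuotients.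
Variables (R : comNzRingType) (a : set R).
Hypothesis a_ideal : is_ideal a.
Implicit Types M X : lmodType R.

Lemma ideal_exp1 : ideal_exp a 1 = a.
Proof.
have [_ a_lin] := (is_submodP (V := R^o) a).1 a_ideal.
have [a0 _] := (is_submodP (V := R^o) a).1 a_ideal.
apply/seteqP; split; last first.
  by move=> r ar; apply: sub_gen_smallest; exists r => //; exists 1 => //; exact: mulr1.
apply: (@span_sub R R^o) => // _ [r ar [x _ <-]].
by rewrite -[_ *: _]/(r * x) mulrC -[x * r]addr0; exact: a_lin.
Qed.

Definition power_proj M k : {linear M -> power_quot a M k} :=
  quotmod_proj (ideal_mul (ideal_exp a k) [set: M]).

Lemma power_proj_onto M k : onto (power_proj M k).
Proof. exact: quotmod_proj_onto. Qed.

Lemma power_quot_proj_proj M k l (kl : (k <= l)%N) (x : M) :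
  power_quot_proj a M kl (power_proj M l x) = power_proj M k x.
Proof. exact: (quotmod_map_proj (f := idfun) (@power_quot_subproof R a M k l kl)). Qed.

Lemma power_quot_proj_onto M k l (kl : (k <= l)%N) : onto (power_quot_proj a M kl).
Proof.
move=> q; have [x <-] := power_proj_onto q.
by exists (power_proj M l x); exact: power_quot_proj_proj.
Qed.

Lemma power_quot_proj_comp M k l m (kl : (k <= l)%N) (lm : (l <= m)%N)
    (km : (k <= m)%N) x :
  power_quot_proj a M km x = power_quot_proj a M kl (power_quot_proj a M lm x).
Proof.
have [y <-] := power_proj_onto x; by rewrite !power_quot_proj_proj.
Qed.

Lemma ann_power_quotP M k r : ann (power_quot a M k) r <->
  forall x : M, ideal_mul (ideal_exp a k) [set: M] (r *: x).
Proof.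
have spanE x : span (ideal_mul (ideal_exp a k) [set: M]) x <->
    ideal_mul (ideal_exp a k) [set: M] x.
  split=> [|xk]; last exact: sub_gen_smallest.
  by move: x; apply: span_sub => //; exact: span_submod.
split=> [rann x|rM q].
  by apply/spanE/quotmod_proj_eq0; rewrite linearZ; exact: rann.
have [x <-] := power_proj_onto q; rewrite -linearZ.
by apply/quotmod_proj_eq0/spanE.
Qed.

(** [r M] is in [a M], hence [r^k M] is in [a^k M]. *)
Lemma ann_power_quot_exp M k r :
  ann (power_quot a M 1) r -> ann (power_quot a M k) (r ^+ k).
Proof.
move=> /ann_power_quotP r1; apply/ann_power_quotP; elim: k => [|k IH] x.
  by apply: sub_gen_smallest; exists 1; last by exists x.
rewrite exprSr -scalerA; have := r1 x.
apply: (@span_linear R M M (GRing.scale (r ^+ k))) => _ [b + [y _ <-]].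
rewrite ideal_exp1 => ab; rewrite /= scalerA mulrC -scalerA; have := IH y.
apply: (@span_linear R M M (GRing.scale b)) => _ [c ck [z _ <-]] /=.
apply: sub_gen_smallest; exists (b * c); last by exists z => //; rewrite scalerA.
by apply: sub_gen_smallest; exists b => //; exists c.
Qed.

(** A prime that contains [Ann (M / a^k M)] contains the [k]-th powers of the
    elements of [Ann (M / a M)]. *)
Lemma supported_power_quot M k :
  fg M -> supported (power_quot a M 1) (power_quot a M k).
Proof.
move=> Mfg; split; first exact: fg_onto (@power_proj_onto M k) Mfg.
move=> p [_ p1 pmul] annp r /(@ann_power_quot_exp M k)/annp.
elim: k {annp} => [/p1//|k IH]; rewrite exprS => /pmul[//|]; exact: IH.
Qed.

Lemma ideal_ann_power_quot M r : a r -> ann (power_quot a M 1) r.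
Proof.
move=> ar; apply/ann_power_quotP => x; apply: sub_gen_smallest.
by exists r; [rewrite ideal_exp1|exists x].
Qed.

End PowerQuotients.

(** * Generalized local cohomology *)

Section LocalCohomology.
Variables (R : comNzRingType) (R_noeth : noetherian R) (a : set R).
Hypothesis a_ideal : is_ideal a.
Variables (M X : lmodType R).
Hypothesis M_fg : fg M.

Let T : lmodType R := power_quot a M 1.
Let T_fg : fg T := (supported_power_quot a_ideal 1 M_fg).1.
Let trans i k l (kl : (k <= l)%N) :
  {linear Ext i (power_quot a M k) X -> Ext i (power_quot a M l) X} :=
  Ext_map i X (power_quot_proj a M kl).
Let loc_class i k (x : Ext i (power_quot a M k) X) : gen_loc_cohom a i M X :=
  limcl (trans i) x.

(** Vanishing below degree [i] on all modules supported on [M / a M], the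
    hypothesis under which the transition maps in degree [i] are injective. *)
Definition low_vanish i :=
  forall N, supported T N -> forall j, (j < i)%N -> ext_vanish X j N.

Lemma trans_inj i k l (kl : (k <= l)%N) x :
  low_vanish i -> trans i kl x = 0 -> x = 0.
Proof.
move=> van; apply: (Ext_map_inj_supported R_noeth van).
  exact: power_quot_proj_onto.
exact: supported_power_quot.
Qed.

Lemma loc_class_inj i k (x : Ext i (power_quot a M k) X) :
  low_vanish i -> loc_class x = 0 -> x = 0.
Proof.
move=> van x0; have [|l [kl transx0]] := @limcl_eq0 R _ (trans i) _ k x x0.
  move=> p q r pq qr pr y; apply: Ext_map_comp => z.
  exact: power_quot_proj_comp.
exact: trans_inj transx0.
Qed.

(** In degree [j < n], once the lower degrees vanish, [Ext^j(T, X)] embeds in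
    [H^j = 0], and its vanishing propagates to all supported modules. *)
Lemma low_vanish_of_loc_cohom n :
  (forall i, (i < n)%N -> forall h : gen_loc_cohom a i M X, h = 0) ->
  low_vanish n.
Proof.
elim: n => [|n IH] van N Nsupp j; first by [].
have vanlow : low_vanish n by apply: IH => i ilt; exact/van/leqW.
rewrite ltnS leq_eqVlt => /orP[/eqP->|]; last exact: vanlow.
apply: (ext_vanish_supported R_noeth T_fg vanlow) => // u.
by apply: (loc_class_inj vanlow); exact: van.
Qed.

(** Dividing [N = M / a^(k+1) M] by the generators of [a] leads to a quotient of
    [N] that kills [a N], so it is a quotient of [M / a M]. *)
Lemma ext_power_quot_killed n k (x : Ext n (power_quot a M k.+1) X) :
  low_vanish n -> (forall r, a r -> r *: x = 0) ->
  exists v : Ext n T X, trans n (ltn0Sn k) v = x.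
Proof.
move=> van ax; have [s sE] := R_noeth a_ideal.
have [|r rs|N' [g [v [<- gs]]]] := @Ext_factor_killed R R_noeth X T n van
    (power_quot a M k.+1) x s.
- exact: supported_power_quot.
- apply: ax; have : span ([set` s] : set R^o) r by exact: sub_gen_smallest.
  by rewrite -sE.
have ga r y : a r -> g (r *: y) = 0.
  move=> ar; have rs : span ([set` s] : set R^o) r by rewrite -sE.
  suff : [set r | forall y, g (r *: y) = 0] r by apply.
  move: r rs {ar}; apply: (@span_sub R R^o) => [|r rs z]; last exact: gs.
  apply/is_submodP; split=> [z|c r r' r0 r'0 z].
    by rewrite scale0r linear0.
  by rewrite [_ *: z]scalerDl -[_ *: z]scalerA linearD linearZ /= r0 r'0 scaler0 addr0.
pose p := power_quot_proj a M (ltn0Sn k).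
have [|q pq0|th thE] := @factor_surj R _ _ _ p g.
- exact: power_quot_proj_onto.
- have [y yq] := power_proj_onto q; rewrite -yq in pq0 *.
  move: pq0; rewrite /p power_quot_proj_proj => /quotmod_proj_eq0 y0.
  suff : [set y | g (power_proj a M k.+1 y) = 0] y by [].
  move: y {yq} y0; apply: span_sub => [|y].
    apply/is_submodP; split=> [|c y z y0 z0] /=; first by rewrite !linear0.
    by rewrite !linearP y0 z0 scaler0 addr0.
  apply: span_sub => [|_ [r ar [z _ <-]]].
    apply/is_submodP; split=> [|c t z t0 z0] /=; first by rewrite !linear0.
    by rewrite !linearP t0 z0 scaler0 addr0.
  by rewrite /= linearZ ga // -(ideal_exp1 a_ideal).
exists (Ext_map n X th v).
by rewrite -(Ext_map_comp (h := g)).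
Qed.

Lemma ann_loc_class n k (x : Ext n (power_quot a M k) X) : low_vanish n ->
  [set r | r *: loc_class x = 0] = [set r | r *: x = 0].
Proof.
move=> van; apply/seteqP; split=> r /=.
  by rewrite -limclZ => /(loc_class_inj van).
by move=> rx0; rewrite -limclZ rx0 limcl0.
Qed.

(** Annihilators are the same in [Ext^n(T, X)], in [Ext^n(M / a^k M, X)] and in the
    limit.  A prime annihilator of a class at stage [k] contains [a^k], hence [a],
    so the class comes from [Ext^n(T, X)]. *)
Lemma Ass_loc_cohom n : low_vanish n ->
  Ass (gen_loc_cohom a n M X) = Ass (Ext n T X).
Proof.
move=> van; apply/seteqP; split=> p [pprime]; last first.
  by move=> [v vE]; split=> //; exists (loc_class v); rewrite ann_loc_class.
move=> [h hE]; split=> //.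
(* Stage [0] is the zero module; a stage above [1] is needed to compare with
   [M / a M]. *)
have [[//|k] _ [x hx]] := @limcl_exists R _ (trans n) 1 h.
have pE : p = [set r | r *: x = 0] by rewrite hE hx; exact: ann_loc_class.
have [_ p1 pmul] := pprime.
have ax r : a r -> r *: x = 0.
  move=> ar; suff : p r by rewrite pE.
  have : p (r ^+ k.+1).
    rewrite pE /=; have [|f fE] := @linear_exists R (power_quot a M k.+1)
        (power_quot a M k.+1) (fun y => r ^+ k.+1 *: y).
      by move=> c y z; rewrite scalerDr !scalerA mulrC.
    rewrite -(Ext_map_scale x fE); apply: Ext_map_scale0 => y; rewrite fE.
    apply: (ann_power_quot_exp a_ideal); exact: ideal_ann_power_quot.
  by elim: (k.+1) => [/p1//|m IH]; rewrite exprS => /pmul[].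
have [v vx] := ext_power_quot_killed van ax.
exists v; rewrite pE -vx; apply/seteqP; split=> r /=; last first.
  by move=> rv0; rewrite -linearZ rv0 linear0.
by rewrite -linearZ => /(trans_inj van).
Qed.

End LocalCohomology.

Theorem corollary3p8 (R : comNzRingType) (R_noetherian : noetherian R)
  (a : set R) (a_ideal : is_ideal a)
  (M : lmodType R) (M_fin_gen : fin_gen [set: M]) (X : lmodType R) (n : nat)
  (vanish : forall i : nat, (i < n)%N -> forall h : gen_loc_cohom a i M X, h = 0) :
  Ass (gen_loc_cohom a n M X) =
  Ass (Ext n (quotmod (ideal_mul a [set: M])) X).
Proof.
have M_fg : fg M by have [s sE] := M_fin_gen; exists s => x; rewrite -sE.
rewrite -{2}(ideal_exp1 a_ideal).
apply: (Ass_loc_cohom R_noetherian a_ideal M_fg).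
exact: low_vanish_of_loc_cohom.
Qed.
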